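(* Suppose $F:\mathbb{C}^2\to\mathbb{C}$, $(t,z)\mapsto F(t,z)$, is an entire function satisfying the heat equation $\partial_t F=\partial_z^2 F$ on $\mathbb{C}^2$, and let $f(z)=F(0,z)$ be its initial condition. Then the order $\rho$ of the entire function $f$ satisfies $0\le\rho\le 2$. Furthermore, in the extreme case $\rho=2$ the type $\tau$ of $f$ must be minimal, i.e. $\tau=0$. Conversely, if $f$ is an entire function whose order $\rho$ satisfies $0\le\rho\le 2$ and which, in the case $\rho=2$, has type $0$, then $$F(t,z)=\sum_{j\ge 0}\frac{f^{(2j)}(z)}{j!}\,t^j$$ is entire in $(t,z)$ and satisfies the heat equation $\partial_t F=\partial_z^2 F$ with $F(0,z)=f(z)$.
   Context: For an entire function $g$ with $M(r)=\max_{|z|=r}|g(z)|$, the order is $\rho=\limsup_{r\to\infty}\frac{\ln\ln M(r)}{\ln r}$ (polynomials, including $0$, have order $0$), and, when $0<\rho<\infty$, the type is $\tau=\limsup_{r\to\infty}\frac{\ln M(r)}{r^\rho}\in[0,\infty]$. Here $t$ and $z$ are complex variables. *)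

(* Defs.v *)
From Stdlib Require Export Reals Factorial ClassicalEpsilon.
From Coquelicot Require Export Coquelicot.

Open Scope R_scope.

Definition entire (g : C -> C) : Prop :=
  forall z : C, @ex_derive C_AbsRing C_NormedModule g z.

(* Fréchet differentiability over the scalars [C_AbsRing], so the differential
   at each point is C-linear. *)
Definition entire2 (F : C * C -> C) : Prop :=
  forall p : C * C,
    @ex_filterdiff C_AbsRing (prod_NormedModule C_AbsRing C_NormedModule C_NormedModule)
      C_NormedModule F (locally p).

(* [C_derive] is total: it is the limit of difference quotients along real
   increments, and equals the complex derivative wherever the latter exists
   (is_C_derive_unique), hence everywhere for entire functions and, since their
   derivatives are entire, for all iterates below. *)
Definition C_derive_n (g : C -> C) (n : nat) : C -> C := Nat.iter n C_derive g.

(* Points of C^2 are written (t, z). *)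
Definition heat_equation (F : C * C -> C) : Prop :=
  forall t z : C,
    C_derive (fun s => F (s, z)) t = C_derive_n (fun w => F (t, w)) 2 z.

(* The supremum is a maximum for continuous g and r >= 0. *)
Definition max_modulus (g : C -> C) (r : R) : R :=
  real (Lub_Rbar (fun x => exists z : C, Cmod z = r /\ x = Cmod (g z))).

(* inf_a sup_{r > a} h r, i.e. the limsup of h at +oo, in the extended reals *)
Definition LimSup_infty (h : R -> R) : Rbar :=
  Rbar_glb (fun y => exists a : R,
    y = Lub_Rbar (fun x => exists r : R, a < r /\ x = h r)).

Definition is_polynomial (g : C -> C) : Prop :=
  exists (n : nat) (a : nat -> C),
    forall z : C, g z = sum_n (fun k => (a k * z ^ k)%C) n.

(* Polynomials, including 0, are given order 0 by convention, as ln (ln M(r)) is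
   undefined for constants of modulus at most 1; the limsup formula is used for
   transcendental g, for which M(r) tends to +oo. *)
Definition order (g : C -> C) : Rbar :=
  if excluded_middle_informative (is_polynomial g) then Finite 0
  else LimSup_infty (fun r => ln (ln (max_modulus g r)) / ln r).

(* Only meaningful when 0 < order g < +oo. *)
Definition growth_type (g : C -> C) : Rbar :=
  LimSup_infty (fun r => ln (max_modulus g r) / Rpower r (real (order g))).

(* Main.v *)
Require Import Defs.
From Stdlib Require Import Lra Lia FunctionalExtensionality.

(** Both directions pass through one growth condition on the initial value,
    [gaussian_small]: for every [eps > 0], [|f z| <= exp (eps |z|^2)] once [|z|]
    is large.  For an entire [f] it amounts to order at most 2, with type 0 if
    the order is 2; this is a matter of taking logarithms of the maximum modulus
    ([gaussian_small_order], [gaussian_small_type],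
    [order_type_gaussian_small]).

    If [F] solves the heat equation, let [d_n t] be the [n]-th derivative of
    [F (t, .)] at 0.  The equation gives [d_n' = d_(n+2)], so the derivatives of
    the entire function [d_0] at 0 are the even derivatives of [f] at 0, and
    those of [d_1] are the odd ones.  Cauchy's estimate for [d_0] and [d_1] on a
    disc of radius [T] bounds the Taylor coefficients of [f] of index [2 k] and
    [2 k + 1] by [M / (T^k k!)].  Hence
    [|f z| <= M (1 + |z|) exp (|z|^2 / T)], with [T] as large as one likes
    ([heat_initial_bound]).

    Conversely, let [f] be [gaussian_small].  Cauchy's estimate for
    [f^(2 j) z] on the circle of radius [sqrt x], with [x] a multiple of [j],
    shows that the coefficients [f^(2 j) z / j!] decrease faster than any
    geometric sequence, uniformly for bounded [z] ([heat_coef_bound]).  The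
    series for [F] is then a locally uniform limit of entire functions of [z]
    and a power series in [t]; it can be differentiated term by term in either
    variable, both derivatives in the heat equation have the same series, and
    joint differentiability follows from the two separate ones by Cauchy's
    estimate in [t] ([heat_solution_entire2]).

    The one-variable theory is derived from bare complex differentiability.
    Goursat's bisection argument is run on the form [g (z + w) dw / w] in the
    coordinates [w = exp s * v th], where [v] is a loop around 0.  There the
    loop [v] can be shrunk to 0 through rectangles, which gives Cauchy's formula
    in one stroke ([cauchy_winding]).  The geometric series turns it into the
    Taylor expansion with Cauchy estimates ([entire_disc_coef]), and these
    estimates control all later remainders through [cauchy_first_order]. *)

Open Scope R_scope.

(** * Differentiability and series by epsilons *)

Notation cseries := (@is_series C_AbsRing C_NormedModule) (only parsing).

Lemma sqrt2_lt_2 : sqrt 2 < 2.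
Proof.
  rewrite <- (sqrt_Rsqr 2) at 2 by lra. apply sqrt_lt_1_alt. unfold Rsqr; lra.
Qed.

Definition has_cderiv (g : C -> C) (z l : C) : Prop :=
  forall eps, 0 < eps -> exists delta, 0 < delta /\
    forall h, Cmod h < delta ->
      Cmod (g (z + h) - g z - h * l)%C <= eps * Cmod h.

Lemma is_derive_has_cderiv (g : C -> C) (z l : C) :
  @is_derive C_AbsRing C_NormedModule g z l <-> has_cderiv g z l.
Proof.
  split.
  - intros [_ H] eps He.
    assert (H0 : is_filter_lim (locally (z : AbsRing_NormedModule C_AbsRing)) z)
      by (intros P HP; exact HP).
    destruct (H z H0 (mkposreal eps He)) as [d Hd].
    exists d; split; [apply cond_pos|]. intros h Hh.
    specialize (Hd (z + h)%C). cbn in Hd.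
    unfold minus, plus, opp, scal, norm, ball in Hd; cbn in Hd.
    unfold AbsRing_ball, abs, minus, plus, opp, mult in Hd; cbn in Hd.
    replace (z + h + - z)%C with h in Hd by ring.
    apply Hd, Hh.
  - intros H. split; [apply is_linear_scal_l|].
    intros x Hx. apply (@is_filter_lim_locally_unique C_AbsRing (AbsRing_NormedModule C_AbsRing)) in Hx. subst x.
    intros eps. destruct (H eps (cond_pos eps)) as (d & Hd0 & Hd).
    exists (mkposreal d Hd0). intros y Hy.
    unfold ball in Hy; cbn in Hy. unfold AbsRing_ball, abs, minus, plus, opp in Hy; cbn in Hy.
    specialize (Hd (y + - z)%C Hy).
    assert (E : forall a b : C, (a + (b + - a))%C = b) by (intros; ring).
    rewrite E in Hd. exact Hd.
Qed.

Lemma C_derive_eq (g : C -> C) (z l : C) : has_cderiv g z l -> C_derive g z = l.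
Proof. intros H. apply is_C_derive_unique, is_derive_has_cderiv, H. Qed.

Lemma entire_has_cderiv (g : C -> C) :
  entire g <-> forall z, exists l, has_cderiv g z l.
Proof.
  split; intros H z; destruct (H z) as [l Hl]; exists l; apply is_derive_has_cderiv, Hl.
Qed.

Lemma entire_C_derive (g : C -> C) (z : C) : entire g -> has_cderiv g z (C_derive g z).
Proof.
  intros H. destruct (proj1 (entire_has_cderiv g) H z) as [l Hl].
  now rewrite (C_derive_eq _ _ _ Hl).
Qed.

(** [|s| + |h|] replaces the Euclidean product norm, to which it is
    equivalent. *)
Definition has_cderiv2 (F : C * C -> C) (t z l1 l2 : C) : Prop :=
  forall eps, 0 < eps -> exists delta, 0 < delta /\
    forall s h, Cmod s < delta -> Cmod h < delta ->
      Cmod (F (t + s, z + h) - F (t, z) - s * l1 - h * l2)%C <= eps * (Cmod s + Cmod h).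

Lemma prod_norm_le (s h : C) :
  @norm _ (prod_NormedModule C_AbsRing C_NormedModule C_NormedModule) (s, h)
  <= Cmod s + Cmod h.
Proof.
  cbn. unfold prod_norm. cbn.
  pose proof (Cmod_ge_0 s); pose proof (Cmod_ge_0 h).
  change (@norm _ C_NormedModule s) with (Cmod s).
  change (@norm _ C_NormedModule h) with (Cmod h).
  rewrite <- (sqrt_Rsqr (Cmod s + Cmod h)) by lra.
  apply sqrt_le_1_alt. unfold Rsqr. nra.
Qed.

Lemma prod_norm_ge (s h : C) :
  Cmod s + Cmod h <=
  2 * @norm _ (prod_NormedModule C_AbsRing C_NormedModule C_NormedModule) (s, h).
Proof.
  cbn. unfold prod_norm. cbn.
  pose proof (Cmod_ge_0 s); pose proof (Cmod_ge_0 h).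
  change (@norm _ C_NormedModule s) with (Cmod s).
  change (@norm _ C_NormedModule h) with (Cmod h).
  assert (Cmod s <= sqrt (Cmod s * (Cmod s * 1) + Cmod h * (Cmod h * 1))).
  { rewrite <- (sqrt_Rsqr (Cmod s)) at 1 by lra. apply sqrt_le_1_alt. unfold Rsqr. nra. }
  assert (Cmod h <= sqrt (Cmod s * (Cmod s * 1) + Cmod h * (Cmod h * 1))).
  { rewrite <- (sqrt_Rsqr (Cmod h)) at 1 by lra. apply sqrt_le_1_alt. unfold Rsqr. nra. }
  lra.
Qed.

Lemma ball_C (x y : C) (e : R) : Cmod (y - x)%C < e -> ball (x : C_UniformSpace) e y.
Proof. intros H. exact (C_NormedModule_mixin_compat1 _ _ _ H). Qed.

Lemma entire2_has_cderiv2 (F : C * C -> C) :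
  entire2 F <-> forall t z, exists l1 l2, has_cderiv2 F t z l1 l2.
Proof.
  set (V2 := prod_NormedModule C_AbsRing C_NormedModule C_NormedModule).
  split.
  - intros H t z. destruct (H (t, z)) as [l [Hlin Hd]].
    exists (l (RtoC 1, RtoC 0)), (l (RtoC 0, RtoC 1)).
    assert (Hl : forall s h : C, l (s, h) = (s * l (RtoC 1, RtoC 0) + h * l (RtoC 0, RtoC 1))%C).
    { intros s h.
      pose proof (@linear_plus C_AbsRing V2 C_NormedModule l Hlin (s, RtoC 0) (RtoC 0, h)) as E1.
      pose proof (@linear_scal C_AbsRing V2 C_NormedModule l Hlin s (RtoC 1, RtoC 0)) as E2.
      pose proof (@linear_scal C_AbsRing V2 C_NormedModule l Hlin h (RtoC 0, RtoC 1)) as E3.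
      change (@plus V2 (s, RtoC 0) (RtoC 0, h)) with (s + 0, 0 + h)%C in E1.
      change (@scal C_AbsRing V2 s (RtoC 1, RtoC 0)) with (s * 1, s * 0)%C in E2.
      change (@scal C_AbsRing V2 h (RtoC 0, RtoC 1)) with (h * 0, h * 1)%C in E3.
      replace (s + 0, 0 + h)%C with (s, h) in E1 by (f_equal; ring).
      replace (s * 1, s * 0)%C with (s, RtoC 0) in E2 by (f_equal; ring).
      replace (h * 0, h * 1)%C with (RtoC 0, h) in E3 by (f_equal; ring).
      rewrite E1, E2, E3. reflexivity. }
    intros eps He.
    assert (H0 : is_filter_lim (locally ((t, z) : V2)) (t, z)) by (intros P HP; exact HP).
    destruct (Hd (t, z) H0 (mkposreal eps He)) as [d Hdd].
    exists d; split; [apply cond_pos|]. intros s h Hs Hh.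
    specialize (Hdd (t + s, z + h)%C).
    assert (Hb : @ball V2 (t, z) d (t + s, z + h)%C).
    { split; apply ball_C; cbn.
      - replace (t + s - t)%C with s by ring; exact Hs.
      - replace (z + h - z)%C with h by ring; exact Hh. }
    specialize (Hdd Hb).
    change (Cmod (F (t + s, z + h) + - F (t, z) + - l ((t + s) + - t, (z + h) + - z))%C
       <= eps * @norm _ V2 ((t + s) + - t, (z + h) + - z)%C) in Hdd.
    replace (t + s + - t)%C with s in Hdd by ring.
    replace (z + h + - z)%C with h in Hdd by ring.
    rewrite Hl in Hdd.
    replace (F (t + s, z + h) - F (t, z) - s * l (RtoC 1, RtoC 0) - h * l (RtoC 0, RtoC 1))%C
      with (F (t + s, z + h) + - F (t, z) + - (s * l (RtoC 1, RtoC 0) + h * l (RtoC 0, RtoC 1)))%C by ring.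
    eapply Rle_trans; [apply Hdd|].
    apply Rmult_le_compat_l; [lra|]. apply prod_norm_le.
  - intros H [t z]. destruct (H t z) as (l1 & l2 & Hd).
    exists (fun p : C * C => (fst p * l1 + snd p * l2)%C). split.
    + split.
      * intros [x1 x2] [y1 y2]. cbn. unfold plus; cbn. ring.
      * intros k [x1 x2]. cbn. unfold scal; cbn. unfold mult; cbn. ring.
      * exists (2 * (Cmod l1 + Cmod l2 + 1)).
        pose proof (Cmod_ge_0 l1); pose proof (Cmod_ge_0 l2).
        split; [lra|]. intros [x1 x2]. cbn [fst snd].
        change (Cmod (x1 * l1 + x2 * l2)%C <= 2 * (Cmod l1 + Cmod l2 + 1) * @norm _ V2 (x1, x2)).
        pose proof (prod_norm_ge x1 x2) as Hn. fold V2 in Hn.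
        pose proof (Cmod_triangle (x1 * l1) (x2 * l2)) as Ht. rewrite !Cmod_mult in Ht.
        pose proof (Cmod_ge_0 x1); pose proof (Cmod_ge_0 x2).
        assert (Cmod x1 * Cmod l1 + Cmod x2 * Cmod l2 <= (Cmod x1 + Cmod x2) * (Cmod l1 + Cmod l2 + 1)) by nra.
        assert ((Cmod x1 + Cmod x2) * (Cmod l1 + Cmod l2 + 1) <=
          2 * @norm _ V2 (x1, x2) * (Cmod l1 + Cmod l2 + 1)) by (apply Rmult_le_compat_r; [lra|exact Hn]).
        replace (2 * (Cmod l1 + Cmod l2 + 1) * @norm _ V2 (x1, x2)) with (2 * @norm _ V2 (x1, x2) * (Cmod l1 + Cmod l2 + 1)) by ring.
        eapply Rle_trans; [apply Ht|]. eapply Rle_trans; eassumption.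
    + intros x Hx. apply (@is_filter_lim_locally_unique C_AbsRing V2) in Hx. subst x.
      intros eps. assert (He : 0 < eps / 2) by (destruct eps; cbn; lra).
      destruct (Hd (eps / 2) He) as (d & Hd0 & Hdd).
      assert (Hd2 : 0 < d / 2) by lra.
      exists (mkposreal (d/2) Hd2). intros [y1 y2] [Hy1 Hy2]. cbn [fst snd] in *.
      pose proof (C_NormedModule_mixin_compat2 _ _ _ Hy1) as A1.
      pose proof (C_NormedModule_mixin_compat2 _ _ _ Hy2) as A2.
      cbn in A1, A2.
      assert (Hs2 : sqrt 2 * (d/2) < d).
      { pose proof sqrt2_lt_2. nra. }
      assert (B1 : Cmod (y1 - t)%C < d) by (eapply Rlt_trans; [exact A1|exact Hs2]).
      assert (B2 : Cmod (y2 - z)%C < d) by (eapply Rlt_trans; [exact A2|exact Hs2]).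
      clear A1 A2 Hy1 Hy2. revert y1 y2 B1 B2.
      change (forall y1 y2 : C, Cmod (y1 - t)%C < d -> Cmod (y2 - z)%C < d ->
        Cmod (F (y1, y2) + - F (t, z) + - ((y1 + - t) * l1 + (y2 + - z) * l2))%C
        <= eps * @norm _ V2 (y1 - t, y2 - z)%C).
      intros y1 y2 B1 B2.
      specialize (Hdd _ _ B1 B2).
      replace (t + (y1 - t))%C with y1 in Hdd by ring.
      replace (z + (y2 - z))%C with y2 in Hdd by ring.
      replace (F (y1, y2) + - F (t, z) + - ((y1 + - t) * l1 + (y2 + - z) * l2))%C with
        (F (y1, y2) - F (t, z) - (y1 - t) * l1 - (y2 - z) * l2)%C by ring.
      pose proof (prod_norm_ge (y1 - t)%C (y2 - z)%C) as Hn. fold V2 in Hn.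
      eapply Rle_trans; [apply Hdd|].
      replace (eps * @norm _ V2 (y1 - t, y2 - z)%C) with (eps / 2 * (2 * @norm _ V2 (y1 - t, y2 - z)%C)) by field.
      apply Rmult_le_compat_l; [lra|exact Hn].
Qed.

Lemma is_series_C_eps (a : nat -> C) (l : C) :
  cseries a l <->
  forall eps, 0 < eps -> exists N, forall n, (N <= n)%nat ->
    Cmod (@sum_n C_NormedModule a n - l)%C < eps.
Proof.
  unfold is_series.
  pose proof (filterlim_locally (U := C_UniformSpace) (F := eventually)
    (@sum_n C_NormedModule a) l) as E.
  split.
  - intros H eps He. assert (He2 : 0 < eps / 2) by lra.
    destruct (proj1 E H (mkposreal _ He2)) as [N HN]. exists N. intros n Hn.
    specialize (HN n Hn).
    pose proof (C_NormedModule_mixin_compat2 _ _ _ HN) as A. cbn in A.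
    eapply Rlt_trans; [exact A|].
    pose proof sqrt2_lt_2. nra.
  - intros H. apply E. intros eps. destruct (H eps (cond_pos eps)) as [N HN]. exists N. intros n Hn.
    apply ball_C. apply HN, Hn.
Qed.

Lemma Cmod_sum_n_le (a : nat -> C) (b : nat -> R) (n : nat) :
  (forall k, Cmod (a k) <= b k) -> Cmod (@sum_n C_NormedModule a n) <= sum_n b n.
Proof.
  intros H. induction n as [|n IH].
  - rewrite !sum_O. apply H.
  - rewrite !sum_Sn. eapply Rle_trans; [apply Cmod_triangle|].
    apply Rplus_le_compat; [exact IH|apply H].
Qed.

Lemma le_of_eps (x y : R) : (forall eps, 0 < eps -> x <= y + eps) -> x <= y.
Proof. intros H. apply Rnot_lt_le. intros Hl. specialize (H ((x - y)/2)). lra. Qed.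

Lemma Cmod_minus_comm (x y : C) : Cmod (x - y)%C = Cmod (y - x)%C.
Proof. rewrite <- Cmod_opp. f_equal. ring. Qed.

Lemma Cmod_minus_le (x y : C) : Cmod (x - y)%C <= Cmod x + Cmod y.
Proof. unfold Cminus. rewrite <- (Cmod_opp y). apply Cmod_triangle. Qed.

Lemma Cmod_le_minus (x y : C) : Cmod x <= Cmod (x - y)%C + Cmod y.
Proof. replace x with ((x - y) + y)%C at 1 by ring. apply Cmod_triangle. Qed.

Lemma is_series_Cmod_le (a : nat -> C) (b : nat -> R) (l : C) (B : R) :
  (forall k, Cmod (a k) <= b k) -> is_series b B ->
  cseries a l -> Cmod l <= B.
Proof.
  intros H Hb Ha. apply le_of_eps. intros eps He.
  destruct (proj1 (is_series_C_eps a l) Ha eps He) as [N HN].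
  specialize (HN N (le_n N)).
  pose proof (Cmod_sum_n_le a b N H).
  assert (sum_n b N <= B).
  { apply (is_lim_seq_incr_compare (sum_n b)).
    - exact Hb.
    - intros n. rewrite sum_Sn. cbn. unfold plus; cbn.
      pose proof (H (S n)). pose proof (Cmod_ge_0 (a (S n))). lra. }
  pose proof (Cmod_le_minus l (@sum_n C_NormedModule a N)).
  rewrite Cmod_minus_comm in H2. lra.
Qed.

Lemma ex_series_Cmod_le (a : nat -> C) (b : nat -> R) :
  (forall k, Cmod (a k) <= b k) -> ex_series b ->
  exists l, cseries a l.
Proof.
  intros H Hb. exact (@ex_series_le C_AbsRing C_CompleteNormedModule a b H Hb).
Qed.

Lemma is_series_C_unique (a : nat -> C) (l l' : C) :
  cseries a l -> cseries a l' -> l = l'.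
Proof.
  intros H H'. apply Ceq_minus. apply Cmod_eq_0.
  apply Rle_antisym; [|apply Cmod_ge_0]. apply le_of_eps. intros eps He.
  destruct (proj1 (is_series_C_eps a l) H (eps/2)) as [N HN]; [lra|].
  destruct (proj1 (is_series_C_eps a l') H' (eps/2)) as [N' HN']; [lra|].
  specialize (HN (Nat.max N N') (Nat.le_max_l _ _)).
  specialize (HN' (Nat.max N N') (Nat.le_max_r _ _)).
  set (s := @sum_n C_NormedModule a (Nat.max N N')) in *.
  replace (l - l')%C with ((s - l') - (s - l))%C by ring.
  pose proof (Cmod_minus_le (s - l') (s - l)). lra.
Qed.

Lemma Cpow_0_l (n : nat) : (RtoC 0 ^ (S n))%C = RtoC 0.
Proof. rewrite Cpow_S. ring. Qed.

Lemma is_series_C_single (a : nat -> C) : (forall n, a (S n) = 0%C) ->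
  cseries a (a O).
Proof.
  intros H. apply is_series_C_eps. intros eps He. exists 0%nat. intros n _.
  replace (@sum_n C_NormedModule a n) with (a O).
  - replace (a O - a O)%C with (RtoC 0) by ring. now rewrite Cmod_0.
  - induction n as [|n IH]; [now rewrite sum_O|].
    rewrite sum_Sn, <- IH, H. symmetry. apply Cplus_0_r.
Qed.

Lemma cseries_ext (a b : nat -> C) (l : C) : (forall n, a n = b n) -> cseries a l -> cseries b l.
Proof. intros H. now apply is_series_ext. Qed.

Lemma cseries_minus (a b : nat -> C) (l m : C) : cseries a l -> cseries b m ->
  cseries (fun n => a n - b n)%C (l - m)%C.
Proof. intros Ha Hb. exact (is_series_minus a b l m Ha Hb). Qed.

Lemma cseries_scal (c : C) (a : nat -> C) (l : C) : cseries a l -> cseries (fun n => c * a n)%C (c * l)%C.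
Proof. intros Ha. exact (is_series_scal c a l Ha). Qed.

Lemma cseries_tail (a : nat -> C) (l : C) : cseries a l -> cseries (fun n => a (S n)) (l - a O)%C.
Proof.
  intros Ha. apply is_series_incr_1. change (cseries a (l - a O + a O)%C).
  now replace (l - a O + a O)%C with l by ring.
Qed.

(** * Continuous paths in the plane and their integrals *)

Definition ccont (f : R -> C) : Prop :=
  forall x eps, 0 < eps -> exists delta, 0 < delta /\
    forall y, Rabs (y - x) < delta -> Cmod (f y - f x)%C < eps.

Lemma ccont_const (c : C) : ccont (fun _ => c).
Proof.
  intros x eps He. exists 1. split; [lra|]. intros y _.
  replace (c - c)%C with (RtoC 0) by ring. now rewrite Cmod_0.
Qed.

Lemma ccont_plus (f g : R -> C) : ccont f -> ccont g -> ccont (fun x => f x + g x)%C.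
Proof.
  intros Hf Hg x eps He.
  destruct (Hf x (eps/2)) as (d1 & Hd1 & H1); [lra|].
  destruct (Hg x (eps/2)) as (d2 & Hd2 & H2); [lra|].
  exists (Rmin d1 d2). split; [now apply Rmin_pos|]. intros y Hy.
  specialize (H1 y (Rlt_le_trans _ _ _ Hy (Rmin_l _ _))).
  specialize (H2 y (Rlt_le_trans _ _ _ Hy (Rmin_r _ _))).
  replace (f y + g y - (f x + g x))%C with ((f y - f x) + (g y - g x))%C by ring.
  pose proof (Cmod_triangle (f y - f x) (g y - g x)). lra.
Qed.

Lemma ccont_mult (f g : R -> C) : ccont f -> ccont g -> ccont (fun x => f x * g x)%C.
Proof.
  intros Hf Hg x eps He.
  pose proof (Cmod_ge_0 (f x)) as Pf; pose proof (Cmod_ge_0 (g x)) as Pg.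
  set (K := Cmod (f x) + Cmod (g x) + 1).
  assert (HK : 0 < K) by (unfold K; lra).
  assert (He' : 0 < Rmin 1 (eps / (2 * K))).
  { apply Rmin_pos; [lra|]. apply Rdiv_lt_0_compat; lra. }
  destruct (Hf x _ He') as (d1 & Hd1 & H1).
  destruct (Hg x _ He') as (d2 & Hd2 & H2).
  exists (Rmin d1 d2). split; [now apply Rmin_pos|]. intros y Hy.
  specialize (H1 y (Rlt_le_trans _ _ _ Hy (Rmin_l _ _))).
  specialize (H2 y (Rlt_le_trans _ _ _ Hy (Rmin_r _ _))).
  set (e := Rmin 1 (eps / (2 * K))) in *.
  assert (E1 : e <= 1) by apply Rmin_l.
  assert (E2 : e * (2 * K) <= eps).
  { assert (e <= eps / (2*K)) by apply Rmin_r.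
    apply Rle_trans with (eps / (2*K) * (2*K)); [apply Rmult_le_compat_r; lra|].
    right. field. lra. }
  replace (f y * g y - f x * g x)%C with
    ((f y - f x) * (g y - g x) + ((f y - f x) * g x + f x * (g y - g x)))%C by ring.
  pose proof (Cmod_triangle ((f y - f x) * (g y - g x)) ((f y - f x) * g x + f x * (g y - g x))) as T1.
  pose proof (Cmod_triangle ((f y - f x) * g x) (f x * (g y - g x))) as T2.
  rewrite Cmod_mult in T1. rewrite !Cmod_mult in T2.
  pose proof (Cmod_ge_0 (f y - f x)); pose proof (Cmod_ge_0 (g y - g x)).
  assert (Cmod (f y - f x) * Cmod (g y - g x) <= e * 1) by (apply Rmult_le_compat; lra).
  assert (Cmod (f y - f x) * Cmod (g x) <= e * Cmod (g x)) by (apply Rmult_le_compat_r; lra).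
  assert (Cmod (f x) * Cmod (g y - g x) <= Cmod (f x) * e) by (apply Rmult_le_compat_l; lra).
  assert (0 < e * K) by (apply Rmult_lt_0_compat; lra).
  unfold K in *. lra.
Qed.

Lemma ccont_inv (f : R -> C) : ccont f -> (forall x, f x <> 0%C) -> ccont (fun x => / f x)%C.
Proof.
  intros Hf Hnz x eps He.
  assert (P : 0 < Cmod (f x)) by (apply Cmod_gt_0, Hnz).
  set (m := Cmod (f x)) in *.
  assert (He' : 0 < Rmin (m / 2) (eps * (m * m) / 2)).
  { apply Rmin_pos; [lra|]. assert (0 < m * m) by nra. nra. }
  destruct (Hf x _ He') as (d & Hd & H).
  exists d. split; [exact Hd|]. intros y Hy. specialize (H y Hy).
  assert (A1 : Cmod (f y - f x)%C < m / 2) by (eapply Rlt_le_trans; [exact H|apply Rmin_l]).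
  assert (A2 : Cmod (f y - f x)%C < eps * (m * m) / 2) by (eapply Rlt_le_trans; [exact H|apply Rmin_r]).
  pose proof (Cmod_le_minus (f x) (f y)) as A3. rewrite Cmod_minus_comm in A3. fold m in A3.
  replace (/ f y - / f x)%C with (- ((f y - f x) * / (f y * f x)))%C.
  2:{ field. split; apply Hnz. }
  rewrite Cmod_opp, Cmod_mult, Cmod_inv by (apply Cmult_neq_0; apply Hnz).
  rewrite Cmod_mult. fold m.
  assert (P2 : m / 2 < Cmod (f y)) by lra.
  assert (P3 : 0 < Cmod (f y) * m) by nra.
  apply Rmult_lt_reg_r with (Cmod (f y) * m); [exact P3|].
  rewrite Rmult_assoc, Rinv_l by lra.
  assert (eps * (m / 2 * m) < eps * (Cmod (f y) * m)).
  { apply Rmult_lt_compat_l; [lra|]. apply Rmult_lt_compat_r; lra. }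
  lra.
Qed.

Lemma has_cderiv_cont (g : C -> C) (z l : C) : has_cderiv g z l ->
  forall eps, 0 < eps -> exists delta, 0 < delta /\
    forall h, Cmod h < delta -> Cmod (g (z + h) - g z)%C < eps.
Proof.
  intros H eps He. destruct (H 1) as (d & Hd & Hh); [lra|].
  pose proof (Cmod_ge_0 l).
  assert (He' : 0 < eps / (2 * (Cmod l + 1))) by (apply Rdiv_lt_0_compat; lra).
  exists (Rmin d (eps / (2 * (Cmod l + 1)))). split; [now apply Rmin_pos|].
  intros h Hm. specialize (Hh h (Rlt_le_trans _ _ _ Hm (Rmin_l _ _))).
  assert (Hm2 : Cmod h < eps / (2 * (Cmod l + 1))) by (eapply Rlt_le_trans; [exact Hm|apply Rmin_r]).
  assert (Hm3 : Cmod h * (2 * (Cmod l + 1)) < eps).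
  { apply Rlt_le_trans with (eps / (2 * (Cmod l + 1)) * (2 * (Cmod l + 1))).
    - apply Rmult_lt_compat_r; lra.
    - right. field. lra. }
  pose proof (Cmod_le_minus (g (z + h) - g z)%C (h * l)%C) as T. rewrite Cmod_mult in T.
  pose proof (Cmod_ge_0 h). nra.
Qed.

Lemma ccont_comp (g : C -> C) (f : R -> C) : entire g -> ccont f -> ccont (fun x => g (f x)).
Proof.
  intros Hg Hf x eps He.
  destruct (has_cderiv_cont _ _ _ (entire_C_derive g (f x) Hg) eps He) as (d & Hd & H).
  destruct (Hf x d Hd) as (d' & Hd' & H').
  exists d'. split; [exact Hd'|]. intros y Hy. specialize (H _ (H' y Hy)).
  replace (f x + (f y - f x))%C with (f y) in H by ring. exact H.
Qed.

Lemma ccont_pair (u v : R -> R) : (forall x, continuous u x) -> (forall x, continuous v x) ->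
  ccont (fun x => (u x, v x)).
Proof.
  intros Hu Hv x eps He.
  assert (He' : 0 < eps / 2) by lra.
  destruct (proj1 (filterlim_locally u (u x)) (Hu x) (mkposreal _ He')) as [d1 H1].
  destruct (proj1 (filterlim_locally v (v x)) (Hv x) (mkposreal _ He')) as [d2 H2].
  exists (Rmin d1 d2). split; [apply Rmin_pos; apply cond_pos|]. intros y Hy.
  specialize (H1 y (Rlt_le_trans _ _ _ Hy (Rmin_l _ _))).
  specialize (H2 y (Rlt_le_trans _ _ _ Hy (Rmin_r _ _))).
  change (Rabs (u y - u x) < eps / 2) in H1. change (Rabs (v y - v x) < eps / 2) in H2.
  apply Rle_lt_trans with (sqrt 2 * Rmax (Rabs (u y - u x)) (Rabs (v y - v x))).
  - apply (Cmod_2Rmax (u y - u x, v y - v x)).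
  - pose proof sqrt2_lt_2.
    assert (Rmax (Rabs (u y - u x)) (Rabs (v y - v x)) < eps / 2) by (apply Rmax_lub_lt; assumption).
    pose proof (Rle_trans _ _ _ (Rabs_pos (u y - u x)) (Rmax_l (Rabs (u y - u x)) (Rabs (v y - v x)))).
    pose proof (sqrt_pos 2). nra.
Qed.

Lemma ccont_continuous (f : R -> C) (x : R) : ccont f ->
  @continuous R_UniformSpace C_UniformSpace f x.
Proof.
  intros Hf. apply filterlim_locally. intros eps.
  destruct (Hf x eps (cond_pos eps)) as (d & Hd & H).
  exists (mkposreal d Hd). intros y Hy. apply ball_C, H, Hy.
Qed.

Lemma ccont_bounded (f : R -> C) (a b : R) : a <= b -> ccont f ->
  exists M, 0 < M /\ forall x, a <= x <= b -> Cmod (f x) <= M.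
Proof.
  intros Hab Hf.
  destruct (continuity_ab_maj (fun x => Cmod (f x)) a b Hab) as (m & Hm & _).
  - intros x _. apply continuity_pt_filterlim.
    apply (filterlim_locally (fun x => Cmod (f x))). intros eps.
    destruct (Hf x eps (cond_pos eps)) as (d & Hd & H).
    exists (mkposreal d Hd). intros y Hy. specialize (H y Hy).
    change (Rabs (Cmod (f y) - Cmod (f x)) < eps).
    pose proof (Cmod_le_minus (f y) (f x)). pose proof (Cmod_le_minus (f x) (f y)) as H1.
    rewrite Cmod_minus_comm in H1. apply Rabs_def1; lra.
  - exists (Cmod (f m) + 1). split; [pose proof (Cmod_ge_0 (f m)); lra|].
    intros x Hx. specialize (Hm x Hx). cbn in Hm. lra.
Qed.

Definition CInt (f : R -> C) (a b : R) : C := @RInt C_R_CompleteNormedModule f a b.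

Lemma ccont_is_RInt (f : R -> C) (a b : R) : ccont f ->
  @is_RInt C_R_NormedModule f a b (CInt f a b).
Proof.
  intros Hf. apply (@RInt_correct C_R_CompleteNormedModule).
  apply (@ex_RInt_continuous C_R_CompleteNormedModule). intros z _. now apply ccont_continuous.
Qed.

Lemma CInt_unique (f : R -> C) (a b : R) (l : C) :
  @is_RInt C_R_NormedModule f a b l -> CInt f a b = l.
Proof. intros H. now apply (@is_RInt_unique C_R_CompleteNormedModule). Qed.

Lemma CInt_plus (f g : R -> C) (a b : R) : ccont f -> ccont g ->
  CInt (fun x => f x + g x)%C a b = (CInt f a b + CInt g a b)%C.
Proof.
  intros Hf Hg. apply CInt_unique.
  apply (@is_RInt_plus C_R_NormedModule); now apply ccont_is_RInt.
Qed.

Lemma CInt_scal (c : C) (f : R -> C) (a b : R) : ccont f ->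
  CInt (fun x => c * f x)%C a b = (c * CInt f a b)%C.
Proof.
  intros Hf. apply CInt_unique.
  pose proof (ccont_is_RInt f a b Hf) as H.
  pose proof (@is_RInt_fct_extend_fst R_NormedModule R_NormedModule f a b _ H) as H1.
  pose proof (@is_RInt_fct_extend_snd R_NormedModule R_NormedModule f a b _ H) as H2.
  destruct c as [c1 c2].
  apply (@is_RInt_fct_extend_pair R_NormedModule R_NormedModule
    (fun x => ((c1, c2) * f x)%C) a b).
  - apply (is_RInt_minus (fun x => c1 * fst (f x)) (fun x => c2 * snd (f x)));
      apply (@is_RInt_scal R_NormedModule); assumption.
  - apply (is_RInt_plus (fun x => c1 * snd (f x)) (fun x => c2 * fst (f x)));
      apply (@is_RInt_scal R_NormedModule); assumption.
Qed.

Lemma CInt_ext (f g : R -> C) (a b : R) : (forall x, f x = g x) -> CInt f a b = CInt g a b.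
Proof. intros H. f_equal. now apply functional_extensionality. Qed.

Lemma ccont_scal (c : C) (f : R -> C) : ccont f -> ccont (fun x => c * f x)%C.
Proof. intros H. apply (ccont_mult (fun _ => c) f); [apply ccont_const|exact H]. Qed.

Lemma ccont_minus (f g : R -> C) : ccont f -> ccont g -> ccont (fun x => f x - g x)%C.
Proof.
  intros Hf Hg. apply ccont_plus; [exact Hf|].
  replace (fun x => - g x)%C with (fun x => (- RtoC 1) * g x)%C.
  - now apply ccont_scal.
  - apply functional_extensionality. intros x. ring.
Qed.

Lemma CInt_minus (f g : R -> C) (a b : R) : ccont f -> ccont g ->
  CInt (fun x => f x - g x)%C a b = (CInt f a b - CInt g a b)%C.
Proof.
  intros Hf Hg. apply CInt_unique.
  apply (@is_RInt_minus C_R_NormedModule); now apply ccont_is_RInt.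
Qed.

Lemma CInt_Chasles (f : R -> C) (a b c : R) : ccont f ->
  CInt f a c = (CInt f a b + CInt f b c)%C.
Proof.
  intros Hf. apply CInt_unique.
  apply (@is_RInt_Chasles C_R_NormedModule f a b c); now apply ccont_is_RInt.
Qed.

Lemma norm_C_R (x : C) : @norm _ C_R_NormedModule x = Cmod x.
Proof.
  cbn. unfold prod_norm, Cmod. cbn.
  change (@norm _ R_NormedModule (fst x)) with (Rabs (fst x)).
  change (@norm _ R_NormedModule (snd x)) with (Rabs (snd x)).
  f_equal. rewrite !Rmult_1_r. f_equal; apply (eq_sym (Rsqr_abs _)).
Qed.

Lemma CInt_bound (f : R -> C) (a b M : R) : a <= b -> ccont f ->
  (forall x, a <= x <= b -> Cmod (f x) <= M) -> Cmod (CInt f a b) <= (b - a) * M.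
Proof.
  intros Hab Hf H. rewrite <- norm_C_R.
  apply (@norm_RInt_le_const C_R_NormedModule f a b); [exact Hab| |now apply ccont_is_RInt].
  intros x Hx. rewrite norm_C_R. now apply H.
Qed.

(** Componentwise, so that the fundamental theorem of calculus reduces to the
    real one. *)
Definition has_rderiv (f : R -> C) (x : R) (l : C) : Prop :=
  is_derive (fun y => fst (f y)) x (fst l) /\ is_derive (fun y => snd (f y)) x (snd l).

Lemma CInt_FTC (f df : R -> C) (a b : R) :
  (forall x, has_rderiv f x (df x)) -> ccont df -> CInt df a b = (f b - f a)%C.
Proof.
  intros Hd Hc.
  pose proof (ccont_is_RInt df a b Hc) as H.
  assert (Hcf : forall x, continuous (fun y => fst (df y)) x /\ continuous (fun y => snd (df y)) x).
  { intros x. pose proof (ccont_continuous df x Hc) as Hx. split.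
    - apply (continuous_comp (V := C_UniformSpace) df fst x Hx).
      apply (@continuous_fst R_UniformSpace R_UniformSpace).
    - apply (continuous_comp (V := C_UniformSpace) df snd x Hx).
      apply (@continuous_snd R_UniformSpace R_UniformSpace). }
  apply CInt_unique.
  apply (@is_RInt_fct_extend_pair R_NormedModule R_NormedModule df a b).
  - apply (@is_RInt_derive R_CompleteNormedModule (fun y => fst (f y)) (fun y => fst (df y)));
      intros x _; [apply Hd|apply Hcf].
  - apply (@is_RInt_derive R_CompleteNormedModule (fun y => snd (f y)) (fun y => snd (df y)));
      intros x _; [apply Hd|apply Hcf].
Qed.

Lemma CInt_const (c : C) (a b : R) : CInt (fun _ => c) a b = (RtoC (b - a) * c)%C.
Proof.
  transitivity (CInt (fun _ => c * RtoC 1)%C a b); [apply CInt_ext; intros; ring|].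
  rewrite CInt_scal by apply ccont_const.
  rewrite (CInt_FTC (fun x => RtoC x) (fun _ => RtoC 1)).
  - rewrite RtoC_minus. ring.
  - intros x. split; cbn; auto_derive; trivial.
  - apply ccont_const.
Qed.

Lemma has_rderiv_lip (f : R -> C) (x : R) (l : C) : has_rderiv f x l ->
  exists L delta, 0 < L /\ 0 < delta /\
    forall y, Rabs (y - x) < delta -> Cmod (f y - f x)%C <= L * Rabs (y - x).
Proof.
  assert (A : forall (u : R -> R) d, is_derive u x d -> exists delta, 0 < delta /\
     forall y, Rabs (y - x) < delta -> Rabs (u y - u x) <= (Rabs d + 1) * Rabs (y - x)).
  { intros u d [_ H].
    assert (H0 : is_filter_lim (locally (x : R_NormedModule)) x) by (intros P HP; exact HP).
    destruct (H x H0 (mkposreal 1 Rlt_0_1)) as [e He].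
    exists e. split; [apply cond_pos|]. intros y Hy. specialize (He y Hy).
    change (Rabs ((u y - u x) - (y - x) * d) <= 1 * Rabs (y - x)) in He.
    pose proof (Rabs_triang ((u y - u x) - (y - x) * d) ((y - x) * d)) as T.
    replace ((u y - u x) - (y - x) * d + (y - x) * d) with (u y - u x) in T by ring.
    rewrite Rabs_mult in T. nra. }
  intros [H1 H2].
  destruct (A _ _ H1) as (d1 & Hd1 & L1). destruct (A _ _ H2) as (d2 & Hd2 & L2).
  pose proof (Rabs_pos (fst l)); pose proof (Rabs_pos (snd l)).
  exists (2 * (Rabs (fst l) + Rabs (snd l) + 1)), (Rmin d1 d2).
  split; [lra|]. split; [now apply Rmin_pos|]. intros y Hy.
  specialize (L1 y (Rlt_le_trans _ _ _ Hy (Rmin_l _ _))).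
  specialize (L2 y (Rlt_le_trans _ _ _ Hy (Rmin_r _ _))).
  pose proof (Cmod_2Rmax (f y - f x)%C) as T. cbn [fst snd Cminus Cplus Copp] in T.
  fold (fst (f y) - fst (f x)) (snd (f y) - snd (f x)) in T.
  set (m := Rabs (y - x)) in *. assert (0 <= m) by apply Rabs_pos.
  assert (Hm : Rmax (Rabs (fst (f y) + - fst (f x))) (Rabs (snd (f y) + - snd (f x)))
     <= (Rabs (fst l) + Rabs (snd l) + 1) * m).
  { apply Rmax_lub; [eapply Rle_trans; [apply L1|]|eapply Rle_trans; [apply L2|]]; nra. }
  pose proof sqrt2_lt_2.
  pose proof (sqrt_pos 2).
  pose proof (Rle_trans _ _ _ (Rabs_pos _) (Rmax_l (Rabs (fst (f y) + - fst (f x))) (Rabs (snd (f y) + - snd (f x))))).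
  unfold Rminus in T. nra.
Qed.

Lemma has_rderiv_ccont (f df : R -> C) : (forall x, has_rderiv f x (df x)) -> ccont f.
Proof.
  intros H x eps He. destruct (has_rderiv_lip f x _ (H x)) as (L & d & HL & Hd & HH).
  assert (0 < eps / L) by (apply Rdiv_lt_0_compat; lra).
  exists (Rmin d (eps / L)). split; [now apply Rmin_pos|]. intros y Hy.
  specialize (HH y (Rlt_le_trans _ _ _ Hy (Rmin_l _ _))).
  assert (Hy2 : Rabs (y - x) < eps / L) by (eapply Rlt_le_trans; [exact Hy|apply Rmin_r]).
  apply Rle_lt_trans with (1 := HH).
  apply Rlt_le_trans with (L * (eps / L)); [now apply Rmult_lt_compat_l|].
  right; field; lra.
Qed.

(** * Goursat by bisection *)

(** Goursat's argument without integrals.  If the value on some rectangle were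
    nonzero, repeated quartering would keep a quarter whose value is at least a
    fixed multiple of the squared size; at the common point of the nested
    quarters this contradicts the local bound [o (size^2)]. *)
Lemma additive_rectangle_zero (I : R -> R -> R -> R -> C) :
  (forall a m b c d, I a b c d = I a m c d + I m b c d)%C ->
  (forall a b c m d, I a b c d = I a b c m + I a b m d)%C ->
  (forall x y eps, 0 < eps -> exists delta, 0 < delta /\
     forall a b c d, a <= x <= b -> c <= y <= d -> b - a < delta -> d - c < delta ->
       Cmod (I a b c d) <= eps * (((b - a) + (d - c)) * ((b - a) + (d - c)))) ->
  forall a b c d, a < b -> c < d -> I a b c d = 0%C.
Proof.
  intros Hh Hv Hloc a b c d Hab Hcd.
  apply Cmod_eq_0. apply Rle_antisym; [|apply Cmod_ge_0].
  apply Rnot_lt_le. intros Hpos.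
  set (w := b - a). set (h := d - c).
  assert (Hw : 0 < w) by (unfold w; lra). assert (Hhh : 0 < h) by (unfold h; lra).
  set (K := Cmod (I a b c d) / ((w + h) * (w + h))).
  assert (HK : 0 < K) by (apply Rdiv_lt_0_compat; [exact Hpos|nra]).
  pose (w_ := fun n => w / 2 ^ n). pose (h_ := fun n => h / 2 ^ n).
  assert (Ew : forall n, w_ (S n) = w_ n / 2).
  { intros n. unfold w_. cbn. field. apply pow_nonzero. lra. }
  assert (Eh : forall n, h_ (S n) = h_ n / 2).
  { intros n. unfold h_. cbn. field. apply pow_nonzero. lra. }
  pose (Bad := fun n (p : R * R) =>
    K * ((w_ n + h_ n) * (w_ n + h_ n)) <= Cmod (I (fst p) (fst p + w_ n) (snd p) (snd p + h_ n))).
  pose (Step := fun n (p q : R * R) => Bad (S n) q /\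
    fst p <= fst q /\ fst q + w_ (S n) <= fst p + w_ n /\
    snd p <= snd q /\ snd q + h_ (S n) <= snd p + h_ n).
  assert (Pw : forall n, 0 < w_ n).
  { intros n. apply Rdiv_lt_0_compat; [exact Hw|apply pow_lt; lra]. }
  assert (Ph : forall n, 0 < h_ n).
  { intros n. apply Rdiv_lt_0_compat; [exact Hhh|apply pow_lt; lra]. }
  assert (Hstep : forall n p, Bad n p -> exists q, Step n p q).
  { intros n [x y] HB. unfold Bad in HB; cbn [fst snd] in HB.
    apply NNPP. intros Hno.
    pose proof (Pw n); pose proof (Ph n).
    assert (G : forall x' y', (x' = x \/ x' = x + w_ n / 2) -> (y' = y \/ y' = y + h_ n / 2) ->
      Cmod (I x' (x' + w_ n / 2) y' (y' + h_ n / 2)) < K * ((w_ n + h_ n) * (w_ n + h_ n)) / 4).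
    { intros x' y' Hx' Hy'. apply Rnot_le_lt. intros HB'. apply Hno. exists (x', y').
      unfold Step, Bad. cbn [fst snd]. rewrite Ew, Eh. repeat split.
      - eapply Rle_trans; [|exact HB']. right. field.
      - destruct Hx'; lra.
      - destruct Hx'; lra.
      - destruct Hy'; lra.
      - destruct Hy'; lra. }
    rewrite (Hh x (x + w_ n / 2)), (Hv x (x + w_ n / 2) y (y + h_ n / 2)),
      (Hv (x + w_ n / 2) (x + w_ n) y (y + h_ n / 2)) in HB.
    pose proof (G x y (or_introl eq_refl) (or_introl eq_refl)) as G1.
    pose proof (G x _ (or_introl eq_refl) (or_intror eq_refl)) as G2.
    pose proof (G _ y (or_intror eq_refl) (or_introl eq_refl)) as G3.
    pose proof (G _ _ (or_intror eq_refl) (or_intror eq_refl)) as G4.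
    replace (x + w_ n / 2 + w_ n / 2) with (x + w_ n) in * by field.
    replace (y + h_ n / 2 + h_ n / 2) with (y + h_ n) in * by field.
    set (i1 := I x (x + w_ n / 2) y (y + h_ n / 2)) in *.
    set (i2 := I x (x + w_ n / 2) (y + h_ n / 2) (y + h_ n)) in *.
    set (i3 := I (x + w_ n / 2) (x + w_ n) y (y + h_ n / 2)) in *.
    set (i4 := I (x + w_ n / 2) (x + w_ n) (y + h_ n / 2) (y + h_ n)) in *.
    pose proof (Cmod_triangle (i1 + i2) (i3 + i4)).
    pose proof (Cmod_triangle i1 i2). pose proof (Cmod_triangle i3 i4). lra. }
  pose (next := fun n p => epsilon (inhabits p) (Step n p)).
  pose (P := nat_rect (fun _ => (R * R)%type) (a, c) next).
  assert (HP : forall n, Bad n (P n)).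
  { induction n as [|n IH].
    - unfold Bad, w_, h_. cbn. rewrite !Rdiv_1_r. unfold K.
      replace (a + w) with b by (unfold w; ring). replace (c + h) with d by (unfold h; ring).
      right. field. nra.
    - exact (proj1 (epsilon_spec (inhabits (P n)) (Step n (P n)) (Hstep n _ IH))). }
  assert (HS : forall n, Step n (P n) (P (S n))).
  { intros n. exact (epsilon_spec (inhabits (P n)) (Step n (P n)) (Hstep n _ (HP n))). }
  assert (Hnest : forall (u s : nat -> R), (forall n, 0 < s n) ->
     (forall n, u n <= u (S n) /\ u (S n) + s (S n) <= u n + s n) ->
     exists l, forall n, u n <= l <= u n + s n).
  { intros u s Hs Hu.
    assert (Hb : forall n k, u (n + k)%nat + s (n + k)%nat <= u n + s n).
    { intros n. induction k as [|k IH]; [rewrite Nat.add_0_r; lra|].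
      rewrite Nat.add_succ_r. pose proof (Hu (n + k)%nat). lra. }
    assert (Hi : forall n k, u n <= u (n + k)%nat).
    { intros n. induction k as [|k IH]; [rewrite Nat.add_0_r; lra|].
      rewrite Nat.add_succ_r. pose proof (Hu (n + k)%nat). lra. }
    destruct (ex_finite_lim_seq_incr u (u 0%nat + s 0%nat)) as [l Hl].
    - intros n. apply Hu.
    - intros n. pose proof (Hb 0%nat n). cbn in H. pose proof (Hs n). lra.
    - exists l. intros n. split.
      + apply (is_lim_seq_incr_compare u); [exact Hl|]. intros k; apply Hu.
      + apply (is_lim_seq_le_loc u (fun _ => u n + s n) l (u n + s n)); [|exact Hl|apply is_lim_seq_const].
        exists n. intros m Hm. replace m with (n + (m - n))%nat by lia.
        pose proof (Hb n (m - n)%nat). pose proof (Hs (n + (m - n))%nat). lra. }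
  destruct (Hnest (fun n => fst (P n)) w_ Pw) as [x Hx].
  { intros n. destruct (HS n) as (_ & ? & ? & _). now split. }
  destruct (Hnest (fun n => snd (P n)) h_ Ph) as [y Hy].
  { intros n. destruct (HS n) as (_ & _ & _ & ? & ?). now split. }
  destruct (Hloc x y (K / 2)) as (delta & Hdelta & Hd); [lra|].
  assert (Hlim : exists n, w_ n < delta /\ h_ n < delta).
  { assert (Hl : is_lim_seq (fun n => (w + h) * (/2) ^ n) ((w + h) * 0)).
    { apply (is_lim_seq_scal_l _ (w + h) 0). apply is_lim_seq_geom. rewrite Rabs_pos_eq; lra. }
    rewrite Rmult_0_r in Hl.
    apply is_lim_seq_spec in Hl. destruct (Hl (mkposreal _ Hdelta)) as [n Hn].
    exists n. specialize (Hn n (le_n n)). cbn in Hn. rewrite Rminus_0_r in Hn.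
    pose proof (Rle_abs ((w + h) * (/2)^n)).
    pose proof (Pw n) as Q1; pose proof (Ph n) as Q2.
    assert (E : (w + h) * (/2)^n = w_ n + h_ n).
    { unfold w_, h_. rewrite pow_inv. field. apply pow_nonzero. lra. }
    lra. }
  destruct Hlim as (n & Hn1 & Hn2).
  specialize (Hd (fst (P n)) (fst (P n) + w_ n) (snd (P n)) (snd (P n) + h_ n) (Hx n) (Hy n)).
  specialize (HP n). unfold Bad in HP.
  replace (fst (P n) + w_ n - fst (P n)) with (w_ n) in Hd by ring.
  replace (snd (P n) + h_ n - snd (P n)) with (h_ n) in Hd by ring.
  specialize (Hd Hn1 Hn2). pose proof (Pw n); pose proof (Ph n).
  assert (0 < (w_ n + h_ n) * (w_ n + h_ n)) by nra. nra.
Qed.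

Lemma ccont_exp : ccont (fun s => RtoC (exp s)).
Proof.
  apply (ccont_pair exp (fun _ => 0)).
  - intros x. apply (ex_derive_continuous exp). exists (exp x). auto_derive; [trivial|ring].
  - intros x. apply continuous_const.
Qed.

Lemma has_rderiv_exp (c : C) (x : R) :
  has_rderiv (fun s => RtoC (exp s) * c)%C x (RtoC (exp x) * c)%C.
Proof.
  destruct c as [c1 c2]. split; cbn; auto_derive; trivial; ring.
Qed.

Lemma has_rderiv_scal (c : C) (f : R -> C) (x : R) (l : C) : has_rderiv f x l ->
  has_rderiv (fun y => c * f y)%C x (c * l)%C.
Proof.
  intros [H1 H2]. destruct c as [c1 c2]. split; cbn [fst snd Cmult].
  - apply (is_derive_minus (fun y => c1 * fst (f y)) (fun y => c2 * snd (f y))).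
    + now apply is_derive_scal.
    + now apply is_derive_scal.
  - apply (is_derive_plus (fun y => c1 * snd (f y)) (fun y => c2 * fst (f y))).
    + now apply is_derive_scal.
    + now apply is_derive_scal.
Qed.

(** The integral of [g (z + w) dw / w] along the boundary of the image of
    [[a, b] x [c, d]] under [(s, th) |-> w = exp s * v th], up to sign; here
    [dw / w = ds + (v' / v) dth].  The factor [exp s]
    moves the origin of the [w]-plane to [s = -oo], so all rectangles are
    allowed and additivity has no side condition. *)
Definition edge_sum (v dv : R -> C) (z : C) (g : C -> C) (a b c d : R) : C :=
  (CInt (fun s => g (z + RtoC (exp s) * v c) - g (z + RtoC (exp s) * v d)) a b +
   CInt (fun th => (g (z + RtoC (exp b) * v th) - g (z + RtoC (exp a) * v th)) * (dv th * / v th)) c d)%C.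

Definition nonvanishing_path (v dv : R -> C) : Prop :=
  (forall th, has_rderiv v th (dv th)) /\ ccont dv /\ (forall th, v th <> 0%C).

Lemma ccont_ray (z c : C) : ccont (fun s => z + RtoC (exp s) * c)%C.
Proof.
  apply ccont_plus; [apply ccont_const|]. apply ccont_mult; [apply ccont_exp|apply ccont_const].
Qed.

Lemma ccont_arc (v dv : R -> C) (z : C) (s : R) : nonvanishing_path v dv ->
  ccont (fun th => z + RtoC (exp s) * v th)%C.
Proof.
  intros (Hv & _). apply ccont_plus; [apply ccont_const|]. apply ccont_scal.
  now apply (has_rderiv_ccont v dv).
Qed.

Lemma ccont_dlog (v dv : R -> C) : nonvanishing_path v dv -> ccont (fun th => dv th * / v th)%C.
Proof.
  intros (Hv & Hc & Hnz). apply ccont_mult; [exact Hc|]. apply ccont_inv; [|exact Hnz].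
  now apply (has_rderiv_ccont v dv).
Qed.

Lemma entire_affine (al be z0 : C) : entire (fun z => al + be * (z - z0))%C.
Proof.
  apply entire_has_cderiv. intros z. exists be. intros eps He. exists 1. split; [lra|].
  intros h _. replace (al + be * (z + h - z0) - (al + be * (z - z0)) - h * be)%C with (RtoC 0) by ring.
  rewrite Cmod_0. pose proof (Cmod_ge_0 h). nra.
Qed.

Lemma entire_minus_affine (g : C -> C) (al be z0 : C) : entire g ->
  entire (fun z => g z - (al + be * (z - z0)))%C.
Proof.
  intros Hg. apply entire_has_cderiv. intros z. exists (C_derive g z - be)%C.
  intros eps He. destruct (entire_C_derive g z Hg eps He) as (d & Hd & H).
  exists d. split; [exact Hd|]. intros h Hh.
  replace (g (z + h) - (al + be * (z + h - z0)) - (g z - (al + be * (z - z0)))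
    - h * (C_derive g z - be))%C with (g (z + h) - g z - h * C_derive g z)%C by ring.
  now apply H.
Qed.

Lemma exp_small (e : R) : 0 < e -> exists a, a < 0 /\ exp a < e.
Proof.
  intros He. exists (Rmin (-1) (ln e - 1)). split.
  - pose proof (Rmin_l (-1) (ln e - 1)). lra.
  - apply Rle_lt_trans with (exp (ln e - 1)).
    + destruct (Req_dec (Rmin (-1) (ln e - 1)) (ln e - 1)) as [->|N]; [lra|].
      left. apply exp_increasing. pose proof (Rmin_r (-1) (ln e - 1)). lra.
    + rewrite <- (exp_ln e He) at 2. apply exp_increasing. lra.
Qed.

Section Edge.
Context (v dv : R -> C) (z : C) (Hp : nonvanishing_path v dv).

Lemma ccont_edge_h (g : C -> C) (c d : R) : entire g ->
  ccont (fun s => g (z + RtoC (exp s) * v c) - g (z + RtoC (exp s) * v d))%C.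
Proof.
  intros Hg. apply ccont_minus; apply (ccont_comp g (fun s => z + RtoC (exp s) * v _)%C);
    auto using ccont_ray.
Qed.

Lemma ccont_edge_v (g : C -> C) (a b : R) : entire g ->
  ccont (fun th => (g (z + RtoC (exp b) * v th) - g (z + RtoC (exp a) * v th)) * (dv th * / v th))%C.
Proof.
  intros Hg. apply ccont_mult; [|now apply ccont_dlog].
  apply ccont_minus; apply (ccont_comp g (fun th => z + RtoC (exp _) * v th)%C);
    try exact Hg; eapply ccont_arc; exact Hp.
Qed.

Lemma edge_sum_split_h (g : C -> C) (a m b c d : R) : entire g ->
  edge_sum v dv z g a b c d = (edge_sum v dv z g a m c d + edge_sum v dv z g m b c d)%C.
Proof.
  intros Hg. unfold edge_sum.
  rewrite (CInt_Chasles _ a m b) by now apply ccont_edge_h.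
  rewrite (CInt_ext _ (fun th =>
    (g (z + RtoC (exp m) * v th) - g (z + RtoC (exp a) * v th)) * (dv th * / v th) +
    (g (z + RtoC (exp b) * v th) - g (z + RtoC (exp m) * v th)) * (dv th * / v th))%C c d)
    by (intros; ring).
  rewrite CInt_plus by now apply ccont_edge_v. ring.
Qed.

Lemma edge_sum_split_v (g : C -> C) (a b c m d : R) : entire g ->
  edge_sum v dv z g a b c d = (edge_sum v dv z g a b c m + edge_sum v dv z g a b m d)%C.
Proof.
  intros Hg. unfold edge_sum.
  rewrite (CInt_Chasles _ c m d) by now apply ccont_edge_v.
  rewrite (CInt_ext _ (fun s =>
    (g (z + RtoC (exp s) * v c) - g (z + RtoC (exp s) * v m)) +
    (g (z + RtoC (exp s) * v m) - g (z + RtoC (exp s) * v d)))%C a b)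
    by (intros; ring).
  rewrite CInt_plus by now apply ccont_edge_h. ring.
Qed.

(** For a constant function opposite sides cancel, because the coefficients of
    [dw / w = ds + (v' / v) dth] depend only on the coordinate along the side.
    The linear part contributes the integral of the exact form [be * dw]. *)
Lemma edge_sum_affine (al be z0 : C) (a b c d : R) :
  edge_sum v dv z (fun w => al + be * (w - z0))%C a b c d = 0%C.
Proof.
  unfold edge_sum.
  rewrite (CInt_ext (fun s => al + be * (z + RtoC (exp s) * v c - z0)
      - (al + be * (z + RtoC (exp s) * v d - z0)))%C
    (fun s => RtoC (exp s) * (be * (v c - v d)))%C a b) by (intros; ring).
  rewrite (CInt_ext (fun th => (al + be * (z + RtoC (exp b) * v th - z0)
      - (al + be * (z + RtoC (exp a) * v th - z0))) * (dv th * / v th))%C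
    (fun th => (be * (RtoC (exp b) - RtoC (exp a))) * dv th)%C c d).
  2:{ intros x. destruct Hp as (_ & _ & Hnz). field. apply Hnz. }
  rewrite (CInt_FTC (fun s => RtoC (exp s) * (be * (v c - v d)))%C
    (fun s => RtoC (exp s) * (be * (v c - v d)))%C a b).
  2: intros; apply has_rderiv_exp.
  2: apply ccont_mult; [apply ccont_exp|apply ccont_const].
  rewrite CInt_scal by apply (proj1 (proj2 Hp)).
  rewrite (CInt_FTC v dv c d) by apply Hp. ring.
Qed.

Lemma edge_sum_minus (g k : C -> C) (a b c d : R) : entire g -> entire k ->
  edge_sum v dv z (fun w => g w - k w)%C a b c d
  = (edge_sum v dv z g a b c d - edge_sum v dv z k a b c d)%C.
Proof.
  intros Hg Hk. unfold edge_sum.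
  rewrite (CInt_ext _ (fun s =>
    (g (z + RtoC (exp s) * v c) - g (z + RtoC (exp s) * v d)) -
    (k (z + RtoC (exp s) * v c) - k (z + RtoC (exp s) * v d)))%C a b)
    by (intros; cbv beta; ring).
  rewrite (CInt_ext _ (fun th =>
    (g (z + RtoC (exp b) * v th) - g (z + RtoC (exp a) * v th)) * (dv th * / v th) -
    (k (z + RtoC (exp b) * v th) - k (z + RtoC (exp a) * v th)) * (dv th * / v th))%C c d)
    by (intros th; cbv beta; generalize (dv th * / v th)%C; intros; ring).
  rewrite (CInt_minus _ _ a b) by now apply ccont_edge_h.
  rewrite (CInt_minus _ _ c d) by now apply ccont_edge_v. ring.
Qed.

(** Subtracting from [g] its first-order expansion at a point of the rectangle
    does not change the edge sum, by [edge_sum_affine].  What is left is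
    [o (size)] on each side, and the sides have length [O (size)]. *)
Lemma edge_sum_local (g : C -> C) (x y : R) : entire g ->
  forall eps, 0 < eps -> exists delta, 0 < delta /\
     forall a b c d, a <= x <= b -> c <= y <= d -> b - a < delta -> d - c < delta ->
       Cmod (edge_sum v dv z g a b c d) <= eps * (((b - a) + (d - c)) * ((b - a) + (d - c))).
Proof.
  intros Hg eps He.
  destruct Hp as (Hv & Hc & Hnz).
  set (z0 := (z + RtoC (exp x) * v y)%C).
  destruct (has_rderiv_lip v y _ (Hv y)) as (L1 & d1 & HL1 & Hd1 & Hlip1).
  destruct (has_rderiv_lip _ x _ (has_rderiv_exp 1%C x)) as (L2 & d2 & HL2 & Hd2 & Hlip2).
  destruct (ccont_dlog v dv Hp y 1) as (d3 & Hd3 & Hu); [lra|].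
  set (U := Cmod (dv y * / v y)%C + 1).
  assert (HU : 0 < U) by (unfold U; pose proof (Cmod_ge_0 (dv y * / v y)%C); lra).
  set (L := L1 * exp (x + 1) + L2 * Cmod (v y) + 1).
  pose proof (exp_pos (x + 1)) as Hexp. pose proof (Cmod_ge_0 (v y)) as Hvy.
  assert (HL : 0 < L) by (unfold L; nra).
  assert (Hlip : forall s th, Rabs (s - x) < Rmin 1 d2 -> Rabs (th - y) < d1 ->
    Cmod (z + RtoC (exp s) * v th - z0)%C <= L * (Rabs (s - x) + Rabs (th - y))).
  { intros s th Hs Hth.
    assert (Hs1 : Rabs (s - x) < 1) by (eapply Rlt_le_trans; [exact Hs|apply Rmin_l]).
    assert (Hs2 : Rabs (s - x) < d2) by (eapply Rlt_le_trans; [exact Hs|apply Rmin_r]).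
    specialize (Hlip1 th Hth). specialize (Hlip2 s Hs2).
    unfold z0.
    replace (z + RtoC (exp s) * v th - (z + RtoC (exp x) * v y))%C with
      (RtoC (exp s) * (v th - v y) + (RtoC (exp s) * 1 - RtoC (exp x) * 1) * v y)%C by ring.
    eapply Rle_trans; [apply Cmod_triangle|]. rewrite !Cmod_mult.
    rewrite Cmod_R, (Rabs_pos_eq (exp s)) by (left; apply exp_pos).
    assert (exp s <= exp (x + 1)).
    { left. apply exp_increasing. apply Rabs_def2 in Hs1. lra. }
    assert (exp s * Cmod (v th - v y)%C <= exp (x + 1) * (L1 * Rabs (th - y))).
    { apply Rmult_le_compat; [left; apply exp_pos|apply Cmod_ge_0|assumption|assumption]. }
    assert (Cmod (RtoC (exp s) * 1 - RtoC (exp x) * 1)%C * Cmod (v y) <= L2 * Rabs (s - x) * Cmod (v y))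
      by (apply Rmult_le_compat_r; assumption).
    pose proof (Rabs_pos (s - x)) as Q1. pose proof (Rabs_pos (th - y)) as Q2.
    assert (0 <= (L1 * exp (x + 1) + 1) * Rabs (s - x)) by (apply Rmult_le_pos; nra).
    assert (0 <= (L2 * Cmod (v y) + 1) * Rabs (th - y)) by (apply Rmult_le_pos; nra).
    unfold L. lra. }
  set (e := eps / (2 * L * (1 + U))).
  assert (HLU : 0 < 2 * L * (1 + U)) by (apply Rmult_lt_0_compat; lra).
  assert (Hee : 0 < e) by (apply Rdiv_lt_0_compat; lra).
  destruct (entire_C_derive g z0 Hg e Hee) as (d4 & Hd4 & Hdiff).
  set (delta := Rmin (Rmin (Rmin 1 d2) d1) (Rmin d3 (d4 / (2 * L)))).
  assert (Hd4' : 0 < d4 / (2 * L)) by (apply Rdiv_lt_0_compat; lra).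
  exists delta. split.
  { repeat apply Rmin_pos; try assumption; lra. }
  intros a b c d Hx Hy Hab Hcd.
  assert (D1 : delta <= Rmin 1 d2).
  { eapply Rle_trans; [apply Rmin_l|apply Rmin_l]. }
  assert (D2 : delta <= d1).
  { eapply Rle_trans; [apply Rmin_l|apply Rmin_r]. }
  assert (D3 : delta <= d3).
  { eapply Rle_trans; [apply Rmin_r|apply Rmin_l]. }
  assert (D4 : delta <= d4 / (2 * L)).
  { eapply Rle_trans; [apply Rmin_r|apply Rmin_r]. }
  set (S := (b - a) + (d - c)).
  assert (HS : S < 2 * (d4 / (2 * L))) by (unfold S; lra).
  set (k := fun w => (g z0 + C_derive g z0 * (w - z0))%C).
  set (rho := fun w => (g w - k w)%C).
  assert (Hk : entire k) by apply entire_affine.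
  assert (Hrho : entire rho) by (apply entire_minus_affine; exact Hg).
  assert (E : edge_sum v dv z g a b c d = edge_sum v dv z rho a b c d).
  { unfold rho. rewrite edge_sum_minus by assumption. unfold k. rewrite edge_sum_affine. ring. }
  rewrite E.
  assert (HB : forall s th, a <= s <= b -> c <= th <= d ->
     Cmod (rho (z + RtoC (exp s) * v th))%C <= e * (L * S)).
  { intros s th Hs Hth.
    assert (R1 : Rabs (s - x) <= b - a) by (apply Rabs_le; lra).
    assert (R2 : Rabs (th - y) <= d - c) by (apply Rabs_le; lra).
    assert (HH : Cmod (z + RtoC (exp s) * v th - z0)%C <= L * S).
    { eapply Rle_trans; [apply Hlip; lra|]. apply Rmult_le_compat_l; unfold S; lra. }
    assert (HH2 : L * S < d4).
    { apply Rlt_le_trans with (L * (2 * (d4 / (2 * L)))); [now apply Rmult_lt_compat_l|].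
      right. field. lra. }
    unfold rho, k.
    set (w := (z + RtoC (exp s) * v th)%C) in *.
    specialize (Hdiff (w - z0)%C (Rle_lt_trans _ _ _ HH HH2)).
    replace (z0 + (w - z0))%C with w in Hdiff by ring.
    replace (g w - (g z0 + C_derive g z0 * (w - z0)))%C with
      (g w - g z0 - (w - z0) * C_derive g z0)%C by ring.
    eapply Rle_trans; [exact Hdiff|]. apply Rmult_le_compat_l; lra. }
  assert (HS0 : 0 <= S) by (unfold S; lra).
  set (B := e * (L * S)) in *.
  assert (HB0 : 0 <= B) by (unfold B; apply Rmult_le_pos; [lra|apply Rmult_le_pos; lra]).
  assert (I1 : Cmod (CInt (fun s => rho (z + RtoC (exp s) * v c) - rho (z + RtoC (exp s) * v d))%C a b)
     <= (b - a) * (2 * B)).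
  { apply CInt_bound; [lra|now apply ccont_edge_h|]. intros s Hs.
    eapply Rle_trans; [apply Cmod_minus_le|].
    pose proof (HB s c Hs ltac:(lra)). pose proof (HB s d Hs ltac:(lra)). lra. }
  assert (I2 : Cmod (CInt (fun th => (rho (z + RtoC (exp b) * v th) - rho (z + RtoC (exp a) * v th)) * (dv th * / v th))%C c d)
     <= (d - c) * (2 * B * U)).
  { apply CInt_bound; [lra|now apply ccont_edge_v|]. intros th Hth.
    rewrite Cmod_mult. apply Rmult_le_compat; try apply Cmod_ge_0.
    - eapply Rle_trans; [apply Cmod_minus_le|].
      pose proof (HB b th ltac:(lra) Hth). pose proof (HB a th ltac:(lra) Hth). lra.
    - assert (Rabs (th - y) < d3) by (apply Rabs_def1; lra).
      specialize (Hu th H).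
      pose proof (Cmod_le_minus (dv th * / v th)%C (dv y * / v y)%C). unfold U. lra. }
  unfold edge_sum. eapply Rle_trans; [apply Cmod_triangle|].
  eapply Rle_trans; [apply Rplus_le_compat; [exact I1|exact I2]|].
  assert (Efin : eps * (S * S) = S * (2 * B * (1 + U))).
  { unfold B, e. field. split; lra. }
  fold S. rewrite Efin.
  assert ((b - a) * (2 * B) <= (b - a) * (2 * B * (1 + U))) by (apply Rmult_le_compat_l; [lra|nra]).
  assert ((d - c) * (2 * B * U) <= (d - c) * (2 * B * (1 + U))) by (apply Rmult_le_compat_l; [lra|nra]).
  unfold S. lra.
Qed.

Lemma edge_sum_zero (g : C -> C) (a b c d : R) : entire g -> a < b -> c < d ->
  edge_sum v dv z g a b c d = 0%C.
Proof.
  intros Hg. apply (additive_rectangle_zero (edge_sum v dv z g)).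
  - intros. now apply edge_sum_split_h.
  - intros. now apply edge_sum_split_v.
  - intros x y. now apply edge_sum_local.
Qed.

(** The edge sum over [[a, 0] x [c, d]] vanishes, and its sides [th = c] and
    [th = d] cancel because [v] is a loop.  So the integral along [exp a * v] is
    independent of [a]; as [a] tends to [-oo], [g] may be replaced by [g z]. *)
Lemma cauchy_winding (g : C -> C) (c d : R) : entire g -> c < d -> v c = v d ->
  CInt (fun th => g (z + v th) * (dv th * / v th))%C c d
  = (g z * CInt (fun th => dv th * / v th)%C c d)%C.
Proof.
  intros Hg Hcd Hloop.
  assert (Hu : ccont (fun th => dv th * / v th)%C) by now apply ccont_dlog.
  assert (Hvc : ccont v) by (apply (has_rderiv_ccont v dv); apply Hp).
  assert (Hrw : forall s, ccont (fun th => g (z + RtoC (exp s) * v th) * (dv th * / v th))%C).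
  { intros s. apply ccont_mult; [|exact Hu].
    apply (ccont_comp g (fun th => z + RtoC (exp s) * v th)%C Hg).
    eapply ccont_arc; exact Hp. }
  assert (Hconst : forall a, a < 0 ->
     CInt (fun th => g (z + RtoC (exp a) * v th) * (dv th * / v th))%C c d
     = CInt (fun th => g (z + v th) * (dv th * / v th))%C c d).
  { intros a Ha. pose proof (edge_sum_zero g a 0 c d Hg Ha Hcd) as E.
    unfold edge_sum in E. rewrite Hloop in E.
    rewrite (CInt_ext _ (fun s => RtoC 0 * RtoC (exp s))%C a 0) in E by (intros; ring).
    rewrite CInt_scal in E by apply ccont_exp.
    rewrite (CInt_ext _ (fun th =>
       g (z + RtoC (exp 0) * v th) * (dv th * / v th) - g (z + RtoC (exp a) * v th) * (dv th * / v th))%C c d) in E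
      by (intros; ring).
    rewrite CInt_minus in E by apply Hrw.
    rewrite exp_0 in E.
    rewrite (CInt_ext (fun th => g (z + 1 * v th) * (dv th * / v th))%C
       (fun th => g (z + v th) * (dv th * / v th))%C c d) in E.
    2:{ intros x. rewrite Cmult_1_l. reflexivity. }
    symmetry. apply Ceq_minus. rewrite <- E. ring. }
  destruct (ccont_bounded v c d) as (V & HV & HbV); [lra|exact Hvc|].
  destruct (ccont_bounded _ c d (Rlt_le _ _ Hcd) Hu) as (U & HU & HbU).
  rewrite <- CInt_scal by exact Hu.
  apply Ceq_minus. apply Cmod_eq_0. apply Rle_antisym; [|apply Cmod_ge_0].
  apply le_of_eps. intros eps He.
  assert (He' : 0 < eps / ((d - c) * U)) by (apply Rdiv_lt_0_compat; [lra|nra]).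
  destruct (has_cderiv_cont _ _ _ (entire_C_derive g z Hg) _ He') as (del & Hdel & Hcont).
  destruct (exp_small (del / V)) as (a & Ha & Hea); [now apply Rdiv_lt_0_compat|].
  rewrite <- (Hconst a Ha).
  rewrite <- CInt_minus by (apply Hrw || now apply ccont_scal).
  rewrite Rplus_0_l.
  replace eps with ((d - c) * (eps / ((d - c) * U) * U)) by (field; lra).
  apply CInt_bound; [lra| |].
  { apply ccont_minus; [apply Hrw|now apply ccont_scal]. }
  intros th Hth.
  replace (g (z + RtoC (exp a) * v th) * (dv th * / v th) - g z * (dv th * / v th))%C
    with ((g (z + RtoC (exp a) * v th) - g z) * (dv th * / v th))%C by ring.
  rewrite Cmod_mult. apply Rmult_le_compat; try apply Cmod_ge_0; [|now apply HbU].
  left. apply Hcont. rewrite Cmod_mult, Cmod_R, Rabs_pos_eq by (left; apply exp_pos).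
  apply Rle_lt_trans with (exp a * V).
  - apply Rmult_le_compat_l; [left; apply exp_pos|now apply HbV].
  - apply Rlt_le_trans with (del / V * V); [now apply Rmult_lt_compat_r|].
    right. field. lra.
Qed.

End Edge.

(** * Taylor expansion on a disc *)

Definition circle (r th : R) : C := (r * cos th, r * sin th).

Lemma Cmod_circle (r th : R) : 0 <= r -> Cmod (circle r th) = r.
Proof.
  intros Hr. unfold Cmod, circle. cbn [fst snd].
  replace ((r * cos th) ^ 2 + (r * sin th) ^ 2) with (r * r * ((sin th)² + (cos th)²)).
  - rewrite sin2_cos2, Rmult_1_r. now apply sqrt_square.
  - unfold Rsqr. ring.
Qed.

Lemma circle_nz (r th : R) : 0 < r -> circle r th <> 0%C.
Proof. intros Hr. apply Cmod_gt_0. rewrite Cmod_circle; lra. Qed.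

Lemma has_rderiv_circle (r th : R) : has_rderiv (circle r) th (Ci * circle r th)%C.
Proof.
  split; cbn; auto_derive; trivial; ring.
Qed.

Lemma ccont_circle (r : R) : ccont (circle r).
Proof. eapply has_rderiv_ccont. intros x. apply has_rderiv_circle. Qed.

Lemma circle_pow (r th : R) (n : nat) : (circle r th ^ n)%C = circle (r ^ n) (INR n * th).
Proof.
  induction n as [|n IH].
  - cbn. unfold circle. rewrite Rmult_0_l, cos_0, sin_0.
    apply injective_projections; cbn; ring.
  - rewrite Cpow_S, IH, S_INR. unfold circle.
    rewrite Rmult_plus_distr_r, Rmult_1_l, cos_plus, sin_plus.
    apply injective_projections; cbn; ring.
Qed.

Lemma circle_inv (r th : R) : 0 < r -> (/ circle r th)%C = circle (/ r) (- th).
Proof.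
  intros Hr. pose proof (circle_nz r th Hr) as Hnz.
  assert (E : (circle (/ r) (- th) * circle r th)%C = 1%C).
  { unfold circle. rewrite cos_neg, sin_neg. pose proof (sin2_cos2 th) as H. unfold Rsqr in H.
    apply injective_projections; cbn; field_simplify; try lra. }
  rewrite <- (Cmult_1_l (/ circle r th)), <- E. field. exact Hnz.
Qed.

Lemma ccont_pow (f : R -> C) (n : nat) : ccont f -> ccont (fun x => f x ^ n)%C.
Proof.
  intros Hf. induction n as [|n IH].
  - exact (ccont_const 1%C).
  - exact (ccont_mult f (fun x => f x ^ n)%C Hf IH).
Qed.

Lemma ccont_circle_inv (r : R) : 0 < r -> ccont (fun th => / circle r th)%C.
Proof. intros Hr. apply ccont_inv; [apply ccont_circle|]. intros th. now apply circle_nz. Qed.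

Lemma CInt_circle_pow (r : R) (n : nat) : 0 < r ->
  CInt (fun th => (/ circle r th) ^ S n)%C 0 (2 * PI) = 0%C.
Proof.
  intros Hr.
  set (m := INR (S n)). assert (Hm : 0 < m) by (apply lt_0_INR; lia).
  rewrite (CInt_FTC (fun th => (Ci * / RtoC m) * (/ circle r th) ^ S n)%C).
  - rewrite !(circle_inv r) by exact Hr. rewrite !circle_pow. fold m.
    replace (m * - (2 * PI)) with (- (0 + 2 * m * PI)) by ring.
    replace (circle ((/ r) ^ S n) (- (0 + 2 * m * PI))) with (circle ((/ r) ^ S n) (m * - 0)); [ring|].
    unfold circle. rewrite cos_neg, sin_neg. unfold m.
    rewrite cos_period, sin_period, Ropp_0, Rmult_0_r, sin_0, Ropp_0. reflexivity.
  - intros x.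
    replace (fun th => Ci * / RtoC m * (/ circle r th) ^ S n)%C
      with (fun th => (Ci * / RtoC m) * circle ((/ r) ^ S n) (m * - th))%C.
    2:{ apply functional_extensionality. intros th. rewrite circle_inv, circle_pow by exact Hr. reflexivity. }
    replace ((/ circle r x) ^ S n)%C with
      ((Ci * / RtoC m) * (- RtoC m * (Ci * circle ((/ r) ^ S n) (m * - x))))%C.
    2:{ rewrite circle_inv, circle_pow by exact Hr. fold m.
        assert (Hmz : RtoC m <> 0%C) by (intros E; apply RtoC_inj in E; lra).
        assert (Ei : (Ci * Ci)%C = (- RtoC 1)%C) by (apply injective_projections; cbn; ring).
        transitivity (- (Ci * Ci) * (/ RtoC m * RtoC m) * circle ((/ r) ^ S n) (m * - x))%C; [ring|].
        rewrite Ei, Cinv_l by exact Hmz. ring. }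
    apply has_rderiv_scal. unfold circle. split; cbn [fst snd]; auto_derive; trivial; cbn; ring.
  - apply ccont_pow. now apply ccont_circle_inv.
Qed.

Section Circle.
Context (r : R) (z : C) (Hz : Cmod z < r).

Let kernel (th : R) : C := (Ci * circle r th * / (- z + circle r th))%C.

Lemma kernel_path : nonvanishing_path (fun th => - z + circle r th)%C (fun th => Ci * circle r th)%C.
Proof.
  pose proof (Cmod_ge_0 z) as Pz.
  split; [|split].
  - intros th. split; cbn; auto_derive; trivial; ring.
  - apply ccont_scal, ccont_circle.
  - intros th E.
    assert (circle r th = z) by (rewrite <- (Cplus_0_r z), <- E; ring).
    pose proof (Cmod_circle r th ltac:(lra)) as Hc. rewrite H in Hc. lra.
Qed.

Lemma ccont_kernel : ccont kernel.
Proof. apply (ccont_dlog _ _ kernel_path). Qed.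

(** One step of the geometric expansion of Cauchy's kernel. *)
Lemma kernel_step (th : R) : kernel th = (Ci + z * / circle r th * kernel th)%C.
Proof.
  unfold kernel. pose proof (Cmod_ge_0 z).
  pose proof (proj2 (proj2 kernel_path) th) as Hnz.
  pose proof (circle_nz r th ltac:(lra)) as Hc.
  field. split; [exact Hnz|exact Hc].
Qed.

Definition circle_coef (G : R -> C) (n : nat) : C :=
  CInt (fun th => G th * (/ circle r th) ^ n)%C 0 (2 * PI).

(** Iterating [kernel_step] under the integral gives the partial sums exactly;
    the remainder carries the factor [(z / circle r th)^(n+1)], of modulus
    [(|z| / r)^(n+1)].  No exchange of limit and integral is needed. *)
Lemma kernel_series (G : R -> C) : ccont G ->
  cseries (fun n => Ci * circle_coef G n * z ^ n)%C
    (CInt (fun th => G th * kernel th)%C 0 (2 * PI)).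
Proof.
  intros HG. pose proof (Cmod_ge_0 z) as Pz. assert (Hr : 0 < r) by lra.
  pose proof PI_RGT_0 as HPI.
  set (T := fun n => CInt (fun th => G th * (z * / circle r th) ^ n * kernel th)%C 0 (2 * PI)).
  assert (Cw : forall n, ccont (fun th => G th * (z * / circle r th) ^ n)%C).
  { intros n. apply ccont_mult; [exact HG|]. apply (ccont_pow (fun th => z * / circle r th)%C).
    apply ccont_scal. now apply ccont_circle_inv. }
  assert (CT : forall n, ccont (fun th => G th * (z * / circle r th) ^ n * kernel th)%C).
  { intros n. apply (ccont_mult _ kernel); [apply Cw|apply ccont_kernel]. }
  assert (HT : forall n, T n = (Ci * circle_coef G n * z ^ n + T (S n))%C).
  { intros n. unfold T at 1.
    rewrite (CInt_ext _ (fun th => (Ci * z ^ n) * (G th * (/ circle r th) ^ n) +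
       G th * (z * / circle r th) ^ S n * kernel th)%C).
    2:{ intros th. rewrite Cpow_S, (kernel_step th) at 1. rewrite Cpow_mult_l. ring. }
    rewrite CInt_plus; [|apply ccont_scal|apply CT].
    - rewrite CInt_scal.
      + unfold circle_coef, T. ring.
      + apply ccont_mult; [exact HG|]. apply ccont_pow. now apply ccont_circle_inv.
    - apply ccont_mult; [exact HG|]. apply ccont_pow. now apply ccont_circle_inv. }
  assert (HS : forall n, @sum_n C_NormedModule (fun n => Ci * circle_coef G n * z ^ n)%C n = (T O - T (S n))%C).
  { induction n as [|n IH].
    - rewrite sum_O. change (Ci * circle_coef G 0 * z ^ 0 = T 0%nat - T 1%nat)%C.
      rewrite (HT 0%nat). ring.
    - rewrite sum_Sn, IH, (HT (S n)). 
      change (T 0%nat - (Ci * circle_coef G (S n) * z ^ S n + T (S (S n))) + Ci * circle_coef G (S n) * z ^ S n = T 0%nat - T (S (S n)))%C.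
      ring. }
  assert (H0 : CInt (fun th => G th * kernel th)%C 0 (2 * PI) = T 0%nat).
  { unfold T. apply CInt_ext. intros th. cbn. ring. }
  rewrite H0.
  destruct (ccont_bounded _ 0 (2 * PI) ltac:(lra) HG) as (M & HM & HbM).
  destruct (ccont_bounded _ 0 (2 * PI) ltac:(lra) ccont_kernel) as (U & HU & HbU).
  set (q := Cmod z / r).
  assert (Hq : 0 <= q < 1).
  { split; [apply Rdiv_le_0_compat; lra|]. apply (Rmult_lt_reg_r r); [lra|].
    unfold q, Rdiv. rewrite Rmult_assoc, Rinv_l by lra. lra. }
  assert (HTb : forall n, Cmod (T n) <= 2 * PI * M * U * q ^ n).
  { intros n. replace (2 * PI * M * U * q ^ n) with ((2 * PI - 0) * (M * q ^ n * U)) by ring.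
    unfold T. apply CInt_bound; [lra|apply CT|]. intros th Hth.
    rewrite !Cmod_mult, Cmod_pow, Cmod_mult.
    rewrite (Cmod_inv _ (circle_nz r th Hr)), Cmod_circle by lra. fold (Cmod z / r) q.
    pose proof (pow_le q n (proj1 Hq)).
    apply Rmult_le_compat; [apply Rmult_le_pos; [apply Cmod_ge_0|assumption]|apply Cmod_ge_0| |now apply HbU].
    apply Rmult_le_compat_r; [assumption|now apply HbM]. }
  apply is_series_C_eps. intros eps He.
  assert (Hl : is_lim_seq (fun n => 2 * PI * M * U * q ^ n) (2 * PI * M * U * 0)).
  { apply (is_lim_seq_scal_l _ (2 * PI * M * U) 0). apply is_lim_seq_geom. rewrite Rabs_pos_eq; lra. }
  rewrite Rmult_0_r in Hl. apply is_lim_seq_spec in Hl.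
  destruct (Hl (mkposreal _ He)) as [N HN]. exists N. intros n Hn.
  rewrite HS. replace (T 0%nat - T (S n) - T 0%nat)%C with (- T (S n))%C by ring.
  rewrite Cmod_opp. specialize (HN (S n) ltac:(lia)). cbn in HN. rewrite Rminus_0_r in HN.
  eapply Rle_lt_trans; [apply HTb|]. eapply Rle_lt_trans; [apply Rle_abs|exact HN].
Qed.

(** The winding number: the expansion [kernel_series] of the constant 1 has a
    single nonzero term. *)
Lemma CInt_kernel : CInt kernel 0 (2 * PI) = (Ci * RtoC (2 * PI))%C.
Proof.
  pose proof (Cmod_ge_0 z) as Pz.
  pose proof (kernel_series (fun _ => 1%C) (ccont_const _)) as H.
  assert (H0 : forall n, (Ci * circle_coef (fun _ => 1%C) (S n) * z ^ S n)%C = 0%C).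
  { intros n. unfold circle_coef.
    rewrite (CInt_ext _ (fun th => (/ circle r th) ^ S n)%C) by (intros; ring).
    rewrite CInt_circle_pow by lra. ring. }
  pose proof (is_series_C_unique _ _ _ H (is_series_C_single _ H0)) as E.
  rewrite (CInt_ext _ kernel) in E by (intros; ring). rewrite E.
  unfold circle_coef. rewrite (CInt_ext _ (fun _ => RtoC 1)) by (intros; cbn; ring).
  rewrite CInt_const, Rminus_0_r. cbn. ring.
Qed.

Lemma entire_circle_series (g : C -> C) : entire g ->
  cseries
    (fun n => / RtoC (2 * PI) * circle_coef (fun th => g (circle r th)) n * z ^ n)%C (g z).
Proof.
  intros Hg. pose proof PI_RGT_0 as HPI.
  assert (HG : ccont (fun th => g (circle r th))) by (apply ccont_comp; [exact Hg|apply ccont_circle]).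
  pose proof (kernel_series _ HG) as H.
  pose proof (cauchy_winding _ _ z kernel_path g 0 (2 * PI) Hg ltac:(lra)) as E.
  assert (Ez : (- z + circle r 0)%C = (- z + circle r (2 * PI))%C).
  { f_equal. unfold circle. now rewrite cos_2PI, sin_2PI, cos_0, sin_0. }
  specialize (E Ez).
  change (CInt (fun th => g (z + (- z + circle r th)) * kernel th)%C 0 (2 * PI)
    = (g z * CInt kernel 0 (2 * PI))%C) in E.
  rewrite CInt_kernel in E.
  rewrite (CInt_ext _ (fun th => g (circle r th) * kernel th)%C) in E.
  2:{ intros th. do 2 f_equal. ring. }
  assert (H' := H). cbv beta in H'. rewrite E in H'. clear H. rename H' into H.
  assert (Hpi : RtoC (2 * PI) <> 0%C) by (intros E0; apply RtoC_inj in E0; lra).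
  assert (Hi : Ci <> 0%C) by apply Ci_nz.
  apply (is_series_scal (/ (Ci * RtoC (2 * PI)))%C) in H.
  replace (g z) with (scal (V := C_NormedModule) (/ (Ci * RtoC (2 * PI)))%C (g z * (Ci * RtoC (2 * PI)))%C).
  - eapply is_series_ext; [|exact H]. intros n. cbn beta.
    change (scal (V := C_NormedModule) (/ (Ci * RtoC (2 * PI)))%C ?x) with (/ (Ci * RtoC (2 * PI)) * x)%C.
    set (c := circle_coef _ n). set (zn := (z ^ n)%C).
    change ((/ (Ci * RtoC (2 * PI)) * (Ci * c * zn) = / RtoC (2 * PI) * c * zn)%C).
    field. split; assumption.
  - change (/ (Ci * RtoC (2 * PI)) * (g z * (Ci * RtoC (2 * PI))) = g z)%C.
    field. split; assumption.
Qed.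

End Circle.

Lemma circle_coef_bound (r : R) (G : R -> C) (M : R) (n : nat) : 0 < r -> ccont G ->
  (forall th, 0 <= th <= 2 * PI -> Cmod (G th) <= M) ->
  Cmod (/ RtoC (2 * PI) * circle_coef r G n)%C <= M / r ^ n.
Proof.
  intros Hr HG HM. pose proof PI_RGT_0 as HPI.
  rewrite Cmod_mult, <- RtoC_inv, Cmod_R, Rabs_pos_eq by (try (left; apply Rinv_0_lt_compat); lra).
  assert (Cmod (circle_coef r G n) <= (2 * PI - 0) * (M / r ^ n)).
  { apply CInt_bound; [lra| |].
    - apply ccont_mult; [exact HG|]. apply ccont_pow. now apply ccont_circle_inv.
    - intros th Hth. rewrite Cmod_mult, Cmod_pow, (Cmod_inv _ (circle_nz r th Hr)), Cmod_circle by lra.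
      unfold Rdiv. rewrite pow_inv. apply Rmult_le_compat_r; [|apply HM; lra].
      left. apply Rinv_0_lt_compat. now apply pow_lt. }
  apply Rle_trans with (/ (2 * PI) * ((2 * PI - 0) * (M / r ^ n))).
  - apply Rmult_le_compat_l; [left; apply Rinv_0_lt_compat; lra|assumption].
  - right. field. split; [apply pow_nonzero|]; lra.
Qed.

(** The second bound is the same estimate for an unspecified [M], which exists
    because the circle is compact. *)
Lemma entire_disc_series (g : C -> C) (w : C) (r : R) : entire g -> 0 < r ->
  exists a : nat -> C,
    (forall M, (forall h, Cmod h = r -> Cmod (g (w + h)%C) <= M) -> forall n, Cmod (a n) <= M / r ^ n) /\
    (exists M, forall n, Cmod (a n) <= M / r ^ n) /\
    (forall h, Cmod h < r ->
      cseries (fun n => a n * h ^ n)%C (g (w + h)%C)).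
Proof.
  intros Hg Hr. pose proof PI_RGT_0 as HPI.
  set (k := fun h => g (w + h)%C).
  assert (Hk : entire k).
  { apply entire_has_cderiv. intros z. exists (C_derive g (w + z)).
    intros eps He. destruct (entire_C_derive g (w + z) Hg eps He) as (d & Hd & H).
    exists d. split; [exact Hd|]. intros h Hh. unfold k. rewrite Cplus_assoc. now apply H. }
  assert (HG : ccont (fun th => k (circle r th))) by (apply ccont_comp; [exact Hk|apply ccont_circle]).
  exists (fun n => / RtoC (2 * PI) * circle_coef r (fun th => k (circle r th)) n)%C.
  split; [|split].
  - intros M HM n. apply circle_coef_bound; [exact Hr|exact HG|].
    intros th _. apply HM. apply Cmod_circle. lra.
  - destruct (ccont_bounded _ 0 (2 * PI) ltac:(lra) HG) as (M & _ & HM).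
    exists M. intros n. now apply circle_coef_bound.
  - intros h Hh. now apply (entire_circle_series r h Hh k).
Qed.

(** * Term-by-term differentiation and Cauchy estimates *)

Lemma power_series_remainder (a : nat -> C) (M r : R) (h s : C) : 0 < r -> 
  (forall n, Cmod (a n) <= M / r ^ n) -> Cmod h <= r / 2 ->
  cseries (fun n => a n * h ^ n)%C s ->
  Cmod (s - a 0%nat - h * a 1%nat)%C <= 2 * M / (r * r) * (Cmod h * Cmod h).
Proof.
  intros Hr Ha Hh Hs.
  pose proof (cseries_tail _ _ (cseries_tail _ _ Hs)) as H2. cbn beta in H2.
  replace (s - a 0%nat - h * a 1%nat)%C with (s - a 0%nat * h ^ 0 - a 1%nat * h ^ 1)%C by ring.
  assert (HM : 0 <= M).
  { pose proof (Ha 0%nat). pose proof (Cmod_ge_0 (a 0%nat)). cbn in H. lra. }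
  set (q := Cmod h / r).
  pose proof (Cmod_ge_0 h) as Ph.
  assert (Hq : 0 <= q <= 1 / 2).
  { split; [apply Rdiv_le_0_compat; lra|]. apply (Rmult_le_reg_r r); [lra|].
    unfold q, Rdiv. rewrite Rmult_assoc, Rinv_l by lra. lra. }
  assert (HG : is_series (fun n => (M * (q * q)) * q ^ n) ((M * (q * q)) * / (1 - q))).
  { apply (is_series_scal (M * (q * q)) (fun n => q ^ n)). apply is_series_geom. rewrite Rabs_pos_eq; lra. }
  eapply Rle_trans.
  - refine (is_series_Cmod_le _ _ _ _ _ HG H2).
    intros k. rewrite Cmod_mult, Cmod_pow.
    apply Rle_trans with (M / r ^ S (S k) * Cmod h ^ S (S k)).
    + apply Rmult_le_compat_r; [now apply pow_le|apply Ha].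
    + right. unfold q, Rdiv. rewrite Rpow_mult_distr, pow_inv. cbn. field.
      split; [apply pow_nonzero|]; lra.
  - assert (E : 2 * M / (r * r) * (Cmod h * Cmod h) = M * (q * q) * 2).
    { unfold q. field. lra. }
    rewrite E. apply Rmult_le_compat_l; [apply Rmult_le_pos; nra|].
    replace 2 with (/ (1 / 2)) by field. apply Rinv_le_contravar; lra.
Qed.

Lemma quadratic_cderiv (g : C -> C) (w l : C) (K r : R) : 0 < r ->
  (forall h, Cmod h <= r -> Cmod (g (w + h) - g w - h * l)%C <= K * (Cmod h * Cmod h)) ->
  has_cderiv g w l.
Proof.
  intros Hr H eps He. pose proof (Rabs_pos K) as PK.
  assert (He' : 0 < eps / (Rabs K + 1)) by (apply Rdiv_lt_0_compat; lra).
  exists (Rmin r (eps / (Rabs K + 1))). split; [now apply Rmin_pos|]. intros h Hh.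
  pose proof (Cmod_ge_0 h) as Ph.
  eapply Rle_trans; [apply H|].
  - left. eapply Rlt_le_trans; [exact Hh|apply Rmin_l].
  - rewrite <- Rmult_assoc. apply Rmult_le_compat_r; [exact Ph|].
    assert (Hh2 : Cmod h < eps / (Rabs K + 1)) by (eapply Rlt_le_trans; [exact Hh|apply Rmin_r]).
    apply Rle_trans with ((Rabs K + 1) * Cmod h).
    + apply Rmult_le_compat_r; [exact Ph|]. pose proof (Rle_abs K). lra.
    + apply Rle_trans with ((Rabs K + 1) * (eps / (Rabs K + 1))).
      * apply Rmult_le_compat_l; lra.
      * right. field. lra.
Qed.

(** A bound for [g] on one circle controls the first-order remainder uniformly.
    Termwise differentiation, the equation [d_n' = d_(n+2)] and joint
    differentiability are all obtained by summing or combining such remainders. *)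
Lemma cauchy_first_order (g : C -> C) (w : C) (r M : R) : entire g -> 0 < r ->
  (forall h, Cmod h = r -> Cmod (g (w + h)%C) <= M) ->
  Cmod (C_derive g w) <= M / r /\
  forall h, Cmod h <= r / 2 ->
    Cmod (g (w + h) - g w - h * C_derive g w)%C <= 2 * M / (r * r) * (Cmod h * Cmod h).
Proof.
  intros Hg Hr HM. destruct (entire_disc_series g w r Hg Hr) as (a & Ha & _ & Hs).
  specialize (Ha M HM).
  assert (A0 : g w = a 0%nat).
  { pose proof (Hs 0%C ltac:(rewrite Cmod_0; lra)) as H0. rewrite Cplus_0_r in H0.
    refine (eq_trans (is_series_C_unique _ _ _ H0 (is_series_C_single _ _)) _).
    - intros n. rewrite Cpow_0_l. ring.
    - cbn. ring. }
  assert (HR : forall h, Cmod h <= r / 2 ->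
    Cmod (g (w + h) - g w - h * a 1%nat)%C <= 2 * M / (r * r) * (Cmod h * Cmod h)).
  { intros h Hh. rewrite A0. apply power_series_remainder; try assumption. apply Hs. lra. }
  assert (A1 : C_derive g w = a 1%nat).
  { apply C_derive_eq. apply (quadratic_cderiv g w _ (2 * M / (r * r)) (r / 2)); [lra|exact HR]. }
  rewrite A1. split; [|exact HR]. pose proof (Ha 1%nat) as H1. now rewrite pow_1 in H1.
Qed.

(** Summing the remainders of [cauchy_first_order] over [j]. *)
Lemma series_cderiv (c : nat -> C -> C) (S : C -> C) (w : C) (rho : R) (b : nat -> R) :
  (forall j, entire (c j)) -> 0 < rho -> ex_series b ->
  (forall j h, Cmod h <= rho -> Cmod (c j (w + h)%C) <= b j) ->
  (forall h, Cmod h <= rho -> cseries (fun j => c j (w + h)%C) (S (w + h)%C)) ->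
  (forall j, Cmod (C_derive (c j) w) <= b j / rho) /\
  exists l : C, cseries (fun j => C_derive (c j) w) l /\ has_cderiv S w l.
Proof.
  intros Hc Hrho Hb Hbd HS.
  assert (HC : forall j, Cmod (C_derive (c j) w) <= b j / rho /\
     forall h, Cmod h <= rho / 2 ->
    Cmod (c j (w + h) - c j w - h * C_derive (c j) w)%C <= 2 * b j / (rho * rho) * (Cmod h * Cmod h)).
  { intros j. apply cauchy_first_order; [apply Hc|exact Hrho|]. intros h Hh. apply Hbd. lra. }
  split; [intros j; apply HC|].
  assert (Hb2 : forall k, ex_series (fun j => k * b j)).
  { intros k. exact (ex_series_scal (V := R_NormedModule) k b Hb). }
  destruct (ex_series_Cmod_le (fun j => C_derive (c j) w) (fun j => / rho * b j)) as [l Hl].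
  { intros j. rewrite Rmult_comm. apply HC. }
  { apply Hb2. }
  exists l. split; [exact Hl|].
  set (B := Series b).
  apply (quadratic_cderiv S w l (2 / (rho * rho) * B) (rho / 2)); [lra|].
  intros h Hh. pose proof (Cmod_ge_0 h) as Ph.
  assert (H0 : cseries (fun j => c j w) (S w)).
  { pose proof (HS 0%C ltac:(rewrite Cmod_0; lra)) as H0. rewrite Cplus_0_r in H0. exact H0. }
  pose proof (cseries_minus _ _ _ _ (cseries_minus _ _ _ _ (HS h ltac:(lra)) H0) (cseries_scal h _ _ Hl)) as H1.
  refine (is_series_Cmod_le _ (fun j => (2 / (rho * rho) * (Cmod h * Cmod h)) * b j) _ _ _ _ H1).
  - intros j. eapply Rle_trans; [apply (proj2 (HC j)); exact Hh|]. right. field. lra.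
  - replace (2 / (rho * rho) * B * (Cmod h * Cmod h)) with ((2 / (rho * rho) * (Cmod h * Cmod h)) * B) by ring.
    apply (is_series_scal (V := R_NormedModule)). now apply Series_correct.
Qed.

Lemma has_cderiv_monomial (a : C) (n : nat) (w : C) :
  has_cderiv (fun z => a * z ^ S n)%C w (RtoC (INR (S n)) * a * w ^ n)%C.
Proof.
  revert a. induction n as [|n IH]; intros a.
  - intros eps He. exists 1. split; [lra|]. intros h _.
    replace (a * (w + h) ^ 1 - a * w ^ 1 - h * (RtoC (INR 1) * a * w ^ 0))%C with (RtoC 0) by (cbn; ring).
    rewrite Cmod_0. pose proof (Cmod_ge_0 h). nra.
  - intros eps He. pose proof (Cmod_ge_0 w) as Pw.
    pose proof (IH a) as IHa.
    assert (He1 : 0 < eps / (2 * (Cmod w + 1))) by (apply Rdiv_lt_0_compat; lra).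
    destruct (IHa _ He1) as (d1 & Hd1 & H1).
    destruct (has_cderiv_cont _ _ _ IHa (eps / 2)) as (d2 & Hd2 & H2); [lra|].
    exists (Rmin d1 d2). split; [now apply Rmin_pos|]. intros h Hh.
    specialize (H1 h (Rlt_le_trans _ _ _ Hh (Rmin_l _ _))).
    specialize (H2 h (Rlt_le_trans _ _ _ Hh (Rmin_r _ _))).
    rewrite S_INR, RtoC_plus.
    replace (a * (w + h) ^ S (S n) - a * w ^ S (S n) - h * ((RtoC (INR (S n)) + 1) * a * w ^ S n))%C
      with (w * (a * (w + h) ^ S n - a * w ^ S n - h * (RtoC (INR (S n)) * a * w ^ n))
            + h * (a * (w + h) ^ S n - a * w ^ S n))%C.
    2:{ rewrite !(Cpow_S _ (S n)). rewrite (Cpow_S w n) at 3 4. ring_simplify. rewrite (Cpow_S w n). ring. }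
    eapply Rle_trans; [apply Cmod_triangle|]. rewrite !Cmod_mult.
    pose proof (Cmod_ge_0 h) as Ph.
    assert (T1 : Cmod w * Cmod (a * (w + h) ^ S n - a * w ^ S n - h * (RtoC (INR (S n)) * a * w ^ n))%C
      <= (Cmod w + 1) * (eps / (2 * (Cmod w + 1)) * Cmod h)).
    { apply Rmult_le_compat; [exact Pw|apply Cmod_ge_0|lra|exact H1]. }
    assert (T2 : (Cmod w + 1) * (eps / (2 * (Cmod w + 1)) * Cmod h) = eps / 2 * Cmod h) by (field; lra).
    assert (T3 : Cmod h * Cmod (a * (w + h) ^ S n - a * w ^ S n)%C <= Cmod h * (eps / 2))
      by (apply Rmult_le_compat_l; lra).
    lra.
Qed.

Lemma entire_monomial (a : C) (n : nat) : entire (fun z => a * z ^ n)%C.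
Proof.
  apply entire_has_cderiv. intros w. destruct n as [|n].
  - exists 0%C. intros eps He. exists 1. split; [lra|]. intros h _.
    replace (a * (w + h) ^ 0 - a * w ^ 0 - h * 0)%C with (RtoC 0) by (cbn; ring).
    rewrite Cmod_0. pose proof (Cmod_ge_0 h). nra.
  - eexists. apply has_cderiv_monomial.
Qed.

Lemma C_derive_const_monomial (a : C) (w : C) : C_derive (fun z => a * z ^ 0)%C w = 0%C.
Proof.
  apply C_derive_eq. intros eps He. exists 1. split; [lra|]. intros h _.
  replace (a * (w + h) ^ 0 - a * w ^ 0 - h * 0)%C with (RtoC 0) by (cbn; ring).
  rewrite Cmod_0. pose proof (Cmod_ge_0 h). nra.
Qed.

Lemma INR_le_pow2 (n : nat) : INR (S n) <= 2 ^ n.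
Proof.
  induction n as [|n IH]; [cbn; lra|]. rewrite S_INR. cbn [pow].
  pose proof (pow_R1_Rle 2 n ltac:(lra)). lra.
Qed.

Definition deriv_coef (a : nat -> C) (n : nat) : C := (RtoC (INR (S n)) * a (S n))%C.

Lemma deriv_coef_bound (a : nat -> C) (M r : R) : 0 < r ->
  (forall n, Cmod (a n) <= M / r ^ n) -> forall n, Cmod (deriv_coef a n) <= (M / r) / (r / 2) ^ n.
Proof.
  intros Hr Ha n. unfold deriv_coef. rewrite Cmod_mult, Cmod_R, Rabs_pos_eq by apply pos_INR.
  apply Rle_trans with (2 ^ n * (M / r ^ S n)).
  - apply Rmult_le_compat; [apply pos_INR|apply Cmod_ge_0|apply INR_le_pow2|apply Ha].
  - right. unfold Rdiv. rewrite Rpow_mult_distr, pow_inv. cbn. field.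
    repeat split; try apply pow_nonzero; lra.
Qed.

(** The special case of [series_cderiv] in which the terms are monomials. *)
Lemma power_series_cderiv (a : nat -> C) (g : C -> C) (M r : R) (w : C) : 0 < r ->
  (forall n, Cmod (a n) <= M / r ^ n) ->
  (forall h, Cmod h < r -> cseries (fun n => a n * h ^ n)%C (g h)) ->
  Cmod w < r ->
  has_cderiv g w (C_derive g w) /\
  cseries (fun n => deriv_coef a n * w ^ n)%C (C_derive g w).
Proof.
  intros Hr Ha Hg Hw. pose proof (Cmod_ge_0 w) as Pw.
  set (rho := (r - Cmod w) / 2). assert (Hrho : 0 < rho) by (unfold rho; lra).
  set (q := (Cmod w + rho) / r).
  assert (Hq : 0 <= q < 1).
  { split; [apply Rdiv_le_0_compat; lra|]. apply (Rmult_lt_reg_r r); [lra|].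
    unfold q, Rdiv. rewrite Rmult_assoc, Rinv_l by lra. unfold rho. lra. }
  assert (Hsm : forall h, Cmod h <= rho -> Cmod (w + h)%C <= Cmod w + rho).
  { intros h Hh. pose proof (Cmod_triangle w h). lra. }
  destruct (series_cderiv (fun n z => a n * z ^ n)%C g w rho (fun n => M * q ^ n)) as (_ & l & Hl & Hd).
  - intros j. apply entire_monomial.
  - exact Hrho.
  - apply (ex_series_scal (V := R_NormedModule) M (fun n => q ^ n)). apply ex_series_geom.
    rewrite Rabs_pos_eq; lra.
  - intros j h Hh. rewrite Cmod_mult, Cmod_pow.
    apply Rle_trans with (M / r ^ j * (Cmod w + rho) ^ j).
    + apply Rmult_le_compat; [apply Cmod_ge_0|apply pow_le, Cmod_ge_0|apply Ha|].
      apply pow_incr. split; [apply Cmod_ge_0|now apply Hsm].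
    + right. unfold q, Rdiv. rewrite Rpow_mult_distr, pow_inv. ring.
  - intros h Hh. apply Hg. pose proof (Hsm h Hh). unfold rho in *. lra.
  - rewrite (C_derive_eq _ _ _ Hd). split; [exact Hd|].
    apply cseries_tail in Hl. rewrite C_derive_const_monomial in Hl.
    replace (l - 0)%C with l in Hl by ring.
    eapply cseries_ext; [|exact Hl]. intros n. cbn beta.
    rewrite (C_derive_eq _ _ _ (has_cderiv_monomial (a (S n)) n w)). reflexivity.
Qed.

Lemma has_cderiv_shift (g : C -> C) (w h l : C) :
  has_cderiv g (w + h)%C l <-> has_cderiv (fun k => g (w + k)%C) h l.
Proof.
  split; intros H eps He; destruct (H eps He) as (d & Hd & HH); exists d; split; try exact Hd;
  intros k Hk; specialize (HH k Hk); cbn beta in *; rewrite ?Cplus_assoc in *; exact HH.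
Qed.

(** Near each point the derivative is again a power series, so it can be
    differentiated once more. *)
Lemma entire_C_derive_entire (g : C -> C) : entire g -> entire (C_derive g).
Proof.
  intros Hg. apply entire_has_cderiv. intros w.
  destruct (entire_disc_series g w 2 Hg ltac:(lra)) as (a & _ & (M & Ha) & Hs).
  set (k := fun h => g (w + h)%C).
  assert (HD : forall h, C_derive g (w + h) = C_derive k h).
  { intros h. symmetry. apply C_derive_eq. apply has_cderiv_shift. now apply entire_C_derive. }
  destruct (power_series_cderiv (deriv_coef a) (C_derive k) (M / 2) (2 / 2) 0%C) as (H & _).
  - lra.
  - apply deriv_coef_bound; [lra|exact Ha].
  - intros h Hh. apply (power_series_cderiv a k M 2); try assumption; lra.
  - rewrite Cmod_0. lra.
  - exists (C_derive (C_derive k) 0). rewrite <- (Cplus_0_r w). apply has_cderiv_shift.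
    replace (fun h => C_derive g (w + h)%C) with (C_derive k); [exact H|].
    apply functional_extensionality. intros h. now rewrite HD.
Qed.

Lemma entire_C_derive_n (g : C -> C) (n : nat) : entire g -> entire (C_derive_n g n).
Proof. intros Hg. induction n as [|n IH]; [exact Hg|]. now apply entire_C_derive_entire. Qed.

Lemma C_derive_n_S_r (g : C -> C) (n : nat) : C_derive_n g (S n) = C_derive_n (C_derive g) n.
Proof. unfold C_derive_n. apply Nat.iter_succ_r. Qed.

Lemma C_derive_n_shift (g : C -> C) (w : C) (n : nat) : entire g ->
  C_derive_n (fun h => g (w + h)%C) n = fun h => C_derive_n g n (w + h)%C.
Proof.
  intros Hg. induction n as [|n IH]; [reflexivity|].
  apply functional_extensionality. intros h.
  change (C_derive (C_derive_n (fun h => g (w + h)%C) n) h = C_derive (C_derive_n g n) (w + h)%C).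
  rewrite IH. apply C_derive_eq. apply has_cderiv_shift. apply entire_C_derive.
  now apply entire_C_derive_n.
Qed.

(** In particular the coefficients do not depend on the radius of the disc on
    which the expansion was found. *)
Lemma power_series_coef (n : nat) : forall (a : nat -> C) (g : C -> C) (M r : R), 0 < r ->
  (forall n, Cmod (a n) <= M / r ^ n) ->
  (forall h, Cmod h < r -> cseries (fun n => a n * h ^ n)%C (g h)) ->
  C_derive_n g n 0%C = (RtoC (INR (fact n)) * a n)%C.
Proof.
  induction n as [|n IH]; intros a g M r Hr Ha Hg.
  - pose proof (Hg 0%C ltac:(rewrite Cmod_0; lra)) as H0.
    change (C_derive_n g 0 0%C) with (g 0%C).
    refine (eq_trans (is_series_C_unique _ _ _ H0 (is_series_C_single _ _)) _).
    + intros n. rewrite Cpow_0_l. ring.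
    + cbn. ring.
  - rewrite C_derive_n_S_r.
    rewrite (IH (deriv_coef a) (C_derive g) (M / r) (r / 2)).
    + unfold deriv_coef. rewrite fact_simpl, mult_INR, RtoC_mult. ring.
    + lra.
    + now apply deriv_coef_bound.
    + intros h Hh. apply (power_series_cderiv a g M r h); try assumption; lra.
Qed.

Lemma entire_disc_coef (g : C -> C) (w : C) (r : R) : entire g -> 0 < r ->
  (forall M, (forall h, Cmod h = r -> Cmod (g (w + h)%C) <= M) ->
     forall n, Cmod (C_derive_n g n w / RtoC (INR (fact n)))%C <= M / r ^ n) /\
  (exists M, forall n, Cmod (C_derive_n g n w / RtoC (INR (fact n)))%C <= M / r ^ n) /\
  (forall h, Cmod h < r ->
     cseries (fun n => C_derive_n g n w / RtoC (INR (fact n)) * h ^ n)%C (g (w + h)%C)).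
Proof.
  intros Hg Hr. destruct (entire_disc_series g w r Hg Hr) as (a & H1 & (M & H2) & H3).
  assert (E : a = fun n => (C_derive_n g n w / RtoC (INR (fact n)))%C).
  { apply functional_extensionality. intros n.
    pose proof (power_series_coef n a (fun h => g (w + h)%C) M r Hr H2 H3) as E.
    rewrite (C_derive_n_shift g w n Hg), Cplus_0_r in E. rewrite E.
    field. intros E0. apply RtoC_inj in E0. now apply INR_fact_neq_0 in E0. }
  rewrite E in H1, H2, H3. split; [exact H1|split; [now exists M|exact H3]].
Qed.

Lemma cauchy_estimate (g : C -> C) (w : C) (r M : R) (n : nat) : entire g -> 0 < r ->
  (forall h, Cmod h = r -> Cmod (g (w + h)%C) <= M) ->
  Cmod (C_derive_n g n w / RtoC (INR (fact n)))%C <= M / r ^ n.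
Proof. intros Hg Hr HM. now apply entire_disc_coef. Qed.

Lemma taylor (g : C -> C) (w h : C) : entire g ->
  cseries (fun n => C_derive_n g n w / RtoC (INR (fact n)) * h ^ n)%C (g (w + h)%C).
Proof.
  intros Hg. pose proof (Cmod_ge_0 h).
  apply (entire_disc_coef g w (Cmod h + 1) Hg); lra.
Qed.

Lemma entire_bounded (g : C -> C) (w : C) (r : R) : entire g -> 0 < r ->
  exists M, 0 < M /\ forall h, Cmod h <= r -> Cmod (g (w + h)%C) <= M.
Proof.
  intros Hg Hr. destruct (entire_disc_coef g w (2 * r) Hg ltac:(lra)) as (_ & (M & HM) & Hs).
  assert (PM : 0 <= M).
  { pose proof (HM 0%nat) as H0. rewrite pow_O, Rdiv_1_r in H0.
    eapply Rle_trans; [apply Cmod_ge_0|exact H0]. }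
  exists (M * / (1 - / 2) + 1). split; [lra|]. intros h Hh.
  assert (Hgeo : is_series (fun n => M * (/ 2) ^ n) (M * / (1 - / 2))).
  { apply (is_series_scal (V := R_NormedModule) M (fun n => (/2) ^ n)). apply is_series_geom.
    rewrite Rabs_pos_eq; lra. }
  apply Rle_trans with (M * / (1 - / 2)); [|lra].
  refine (is_series_Cmod_le _ _ _ _ _ Hgeo (Hs h ltac:(lra))).
  intros n. rewrite Cmod_mult, Cmod_pow.
  apply Rle_trans with (M / (2 * r) ^ n * r ^ n).
  - apply Rmult_le_compat; [apply Cmod_ge_0|apply pow_le, Cmod_ge_0|apply HM|].
    apply pow_incr. split; [apply Cmod_ge_0|exact Hh].
  - right. rewrite Rpow_mult_distr, pow_inv. field. split; apply pow_nonzero; lra.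
Qed.

Lemma has_cderiv_lin3 (p q k : C -> C) (c w a1 a2 a3 : C) :
  has_cderiv p w a1 -> has_cderiv q w a2 -> has_cderiv k w a3 ->
  has_cderiv (fun z => p z - q z - c * k z)%C w (a1 - a2 - c * a3)%C.
Proof.
  intros H1 H2 H3 eps He. pose proof (Cmod_ge_0 c) as Pc.
  destruct (H1 (eps / 3)) as (d1 & Hd1 & K1); [lra|].
  destruct (H2 (eps / 3)) as (d2 & Hd2 & K2); [lra|].
  destruct (H3 (eps / (3 * (Cmod c + 1)))) as (d3 & Hd3 & K3); [apply Rdiv_lt_0_compat; lra|].
  exists (Rmin d1 (Rmin d2 d3)). split; [repeat apply Rmin_pos; assumption|]. intros h Hh.
  assert (Hh' : Cmod h < Rmin d2 d3) by (eapply Rlt_le_trans; [exact Hh|apply Rmin_r]).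
  specialize (K1 h (Rlt_le_trans _ _ _ Hh (Rmin_l _ _))).
  specialize (K2 h (Rlt_le_trans _ _ _ Hh' (Rmin_l _ _))).
  specialize (K3 h (Rlt_le_trans _ _ _ Hh' (Rmin_r _ _))).
  replace (p (w + h) - q (w + h) - c * k (w + h) - (p w - q w - c * k w) - h * (a1 - a2 - c * a3))%C
    with ((p (w + h) - p w - h * a1) - (q (w + h) - q w - h * a2) - c * (k (w + h) - k w - h * a3))%C by ring.
  eapply Rle_trans; [apply Cmod_minus_le|]. rewrite Cmod_mult.
  pose proof (Cmod_minus_le (p (w + h) - p w - h * a1)%C (q (w + h) - q w - h * a2)%C).
  assert (Cmod c * Cmod (k (w + h) - k w - h * a3)%C <= (Cmod c + 1) * (eps / (3 * (Cmod c + 1)) * Cmod h)).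
  { apply Rmult_le_compat; [exact Pc|apply Cmod_ge_0|lra|exact K3]. }
  assert ((Cmod c + 1) * (eps / (3 * (Cmod c + 1)) * Cmod h) = eps / 3 * Cmod h) by (field; lra).
  lra.
Qed.

Lemma entire_lin3 (p q k : C -> C) (c : C) : entire p -> entire q -> entire k ->
  entire (fun z => p z - q z - c * k z)%C.
Proof.
  intros Hp Hq Hk. apply entire_has_cderiv. intros w. eexists.
  apply has_cderiv_lin3; now apply entire_C_derive.
Qed.

Lemma C_derive_n_lin3 (p q k : C -> C) (c : C) (n : nat) : entire p -> entire q -> entire k ->
  C_derive_n (fun z => p z - q z - c * k z)%C n
  = fun z => (C_derive_n p n z - C_derive_n q n z - c * C_derive_n k n z)%C.
Proof.
  intros Hp Hq Hk. induction n as [|n IH]; [reflexivity|].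
  apply functional_extensionality. intros z.
  change (C_derive (C_derive_n (fun z => p z - q z - c * k z)%C n) z = C_derive (C_derive_n p n) z
    - C_derive (C_derive_n q n) z - c * C_derive (C_derive_n k n) z)%C.
  rewrite IH. apply C_derive_eq.
  apply has_cderiv_lin3; apply entire_C_derive; now apply entire_C_derive_n.
Qed.

(** * Growth, order and type *)

Lemma C_derive_n_add (g : C -> C) (m n : nat) :
  C_derive_n g (m + n) = C_derive_n (C_derive_n g n) m.
Proof. apply Nat.iter_add. Qed.

Lemma INR_fact_C_nz (n : nat) : RtoC (INR (fact n)) <> 0%C.
Proof. intros E. apply RtoC_inj in E. now apply INR_fact_neq_0 in E. Qed.

Lemma exp_le (x y : R) : x <= y -> exp x <= exp y.
Proof. intros [H|H]; [left; now apply exp_increasing|right; now f_equal]. Qed.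

Definition gaussian_small (f : C -> C) : Prop :=
  forall eps, 0 < eps -> exists r0, forall z, r0 < Cmod z -> Cmod (f z) <= exp (eps * Cmod z ^ 2).

Lemma Cmod_RtoC_pos (r : R) : 0 <= r -> Cmod (RtoC r) = r.
Proof. intros Hr. rewrite Cmod_R. now apply Rabs_pos_eq. Qed.

Lemma max_modulus_finite (f : C -> C) (r : R) : entire f -> 0 <= r ->
  is_lub_Rbar (fun x => exists z : C, Cmod z = r /\ x = Cmod (f z)) (Finite (max_modulus f r)).
Proof.
  intros Hf Hr. unfold max_modulus.
  set (E := fun x => exists z : C, Cmod z = r /\ x = Cmod (f z)).
  pose proof (Lub_Rbar_correct E) as [Hub Hl].
  destruct (entire_bounded f 0%C (r + 1) Hf ltac:(lra)) as (M & HM & Hb).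
  assert (U : Rbar_le (Lub_Rbar E) (Finite M)).
  { apply Hl. intros x (z & Hz & ->). cbn. rewrite <- (Cplus_0_l z). apply Hb. lra. }
  assert (L : Rbar_le (Finite (Cmod (f (RtoC r)))) (Lub_Rbar E)).
  { apply Hub. exists (RtoC r). split; [now apply Cmod_RtoC_pos|reflexivity]. }
  destruct (Lub_Rbar E) as [l| |] eqn:EL; cbn in U, L; try contradiction.
  split; [exact Hub|exact Hl].
Qed.

Lemma max_modulus_ge (f : C -> C) (z : C) : entire f -> Cmod (f z) <= max_modulus f (Cmod z).
Proof.
  intros Hf. destruct (max_modulus_finite f (Cmod z) Hf (Cmod_ge_0 z)) as [H _].
  apply (H (Cmod (f z))). now exists z.
Qed.

Lemma max_modulus_le (f : C -> C) (r B : R) : entire f -> 0 <= r ->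
  (forall z, Cmod z = r -> Cmod (f z) <= B) -> max_modulus f r <= B.
Proof.
  intros Hf Hr HB. destruct (max_modulus_finite f r Hf Hr) as [_ H].
  apply (H (Finite B)). intros x (z & Hz & ->). now apply HB.
Qed.

Lemma Rbar_glb_spec (E : Rbar -> Prop) : Rbar_is_glb E (Rbar_glb E).
Proof. exact (proj2_sig (Rbar_ex_glb E)). Qed.

Lemma LimSup_infty_ge (h : R -> R) (x : R) :
  (forall a, exists r, a < r /\ x <= h r) -> Rbar_le (Finite x) (LimSup_infty h).
Proof.
  intros H. unfold LimSup_infty.
  apply (proj2 (Rbar_glb_spec _)). intros y [a ->].
  destruct (H a) as (r & Hr & Hx).
  apply Rbar_le_trans with (Finite (h r)); [exact Hx|].
  apply (proj1 (Lub_Rbar_correct _)). now exists r.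
Qed.

Lemma LimSup_infty_le (h : R -> R) (y : R) :
  (exists a, forall r, a < r -> h r <= y) -> Rbar_le (LimSup_infty h) (Finite y).
Proof.
  intros [a H]. unfold LimSup_infty.
  eapply Rbar_le_trans; [apply (proj1 (Rbar_glb_spec _)); now exists a|].
  apply (proj2 (Lub_Rbar_correct _)). intros x (r & Hr & ->). now apply H.
Qed.

Lemma LimSup_infty_lt (h : R -> R) (y : R) :
  Rbar_lt (LimSup_infty h) (Finite y) -> exists a, forall r, a < r -> h r <= y.
Proof.
  intros H. apply NNPP. intros Hno.
  apply (Rbar_lt_not_le _ _ H). unfold LimSup_infty.
  apply (proj2 (Rbar_glb_spec _)). intros u [a ->].
  apply Rbar_not_lt_le. intros Hlt. apply Hno. exists a. intros r Hr.
  apply (Rbar_le_trans (Finite (h r)) (Lub_Rbar (fun x => exists r, a < r /\ x = h r)) (Finite y)).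
  - apply (proj1 (Lub_Rbar_correct _)). now exists r.
  - now apply Rbar_lt_le.
Qed.

(** Polynomials need their own argument, as the order is set to 0 for them by
    convention. *)
Lemma polynomial_gaussian_small (f : C -> C) : is_polynomial f -> gaussian_small f.
Proof.
  intros (n & a & Ha) eps He.
  set (A := sum_n (fun k => Cmod (a k)) n).
  assert (Hpow : forall r m, 1 <= r -> r ^ m <= exp (INR m * r)).
  { intros r m Hr. induction m as [|m IH].
    - cbn. rewrite Rmult_0_l, exp_0. lra.
    - rewrite S_INR, Rmult_plus_distr_r, exp_plus, Rmult_1_l. cbn [pow]. rewrite Rmult_comm.
      apply Rmult_le_compat; [apply pow_le; lra|lra|exact IH|].
      pose proof (exp_ineq1 r ltac:(lra)). lra. }
  assert (HA : forall z, 1 <= Cmod z -> Cmod (f z) <= A * Cmod z ^ n).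
  { intros z Hz. rewrite Ha.
    change (sum_n ?u n) with (@sum_n C_NormedModule u n).
    eapply Rle_trans; [apply Cmod_sum_n_le with (b := fun k => Cmod (a k) * Cmod z ^ k)|].
    - intros k. rewrite Cmod_mult, Cmod_pow. lra.
    - unfold A. clear Ha A. 
      assert (G : forall m, (m <= n)%nat -> sum_n (fun k => Cmod (a k) * Cmod z ^ k) m <= sum_n (fun k => Cmod (a k)) m * Cmod z ^ n).
      { induction m as [|m IH]; intros Hm.
        - rewrite !sum_O. apply Rmult_le_compat_l; [apply Cmod_ge_0|]. apply Rle_pow; [exact Hz|lia].
        - rewrite !sum_Sn. change plus with Rplus. rewrite Rmult_plus_distr_r.
          apply Rplus_le_compat; [apply IH; lia|].
          apply Rmult_le_compat_l; [apply Cmod_ge_0|]. apply Rle_pow; [exact Hz|lia]. }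
      apply G. lia. }
  exists (Rmax 1 (Rmax A ((INR n + 1) / eps))). intros z Hz.
  assert (Z1 : 1 < Cmod z) by (eapply Rle_lt_trans; [apply Rmax_l|exact Hz]).
  assert (Z2 : Rmax A ((INR n + 1) / eps) < Cmod z) by (eapply Rle_lt_trans; [apply Rmax_r|exact Hz]).
  assert (Z3 : A < Cmod z) by (eapply Rle_lt_trans; [apply Rmax_l|exact Z2]).
  assert (Z4 : (INR n + 1) / eps < Cmod z) by (eapply Rle_lt_trans; [apply Rmax_r|exact Z2]).
  assert (Z5 : INR n + 1 <= eps * Cmod z).
  { apply Rmult_lt_compat_l with (r := eps) in Z4; [|exact He].
    replace (eps * ((INR n + 1) / eps)) with (INR n + 1) in Z4 by (field; lra). lra. }
  eapply Rle_trans; [apply HA; lra|].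
  apply Rle_trans with (exp (Cmod z) * exp (INR n * Cmod z)).
  - apply Rle_trans with (exp (Cmod z) * Cmod z ^ n).
    + apply Rmult_le_compat_r; [apply pow_le; lra|].
      pose proof (exp_ineq1 (Cmod z) ltac:(lra)). lra.
    + apply Rmult_le_compat_l; [left; apply exp_pos|]. apply Hpow. lra.
  - rewrite <- exp_plus. apply Rnot_lt_le. intros Hlt. apply exp_lt_inv in Hlt. nra.
Qed.

(** Some Taylor coefficient of positive index is nonzero, so Cauchy's estimate
    makes the maximum modulus at least linear.  The bound [exp 1] keeps both
    logarithms in the definition of the order away from their junk values. *)
Lemma transcendental_max_modulus (f : C -> C) : entire f -> ~ is_polynomial f ->
  exists r0, 1 <= r0 /\ forall r, r0 < r -> exp 1 <= max_modulus f r.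
Proof.
  intros Hf Hnp.
  assert (Hn : exists n, C_derive_n f (S n) 0%C <> 0%C).
  { apply NNPP. intros Hno. apply Hnp. exists 0%nat, (fun _ => f 0%C). intros z.
    rewrite sum_O.
    pose proof (taylor f 0%C z Hf) as Ht. rewrite Cplus_0_l in Ht.
    refine (eq_trans (is_series_C_unique _ _ _ Ht (is_series_C_single _ _)) _).
    - intros n. cbn beta.
      replace (C_derive_n f (S n) 0%C) with (RtoC 0).
      + unfold Cdiv. ring.
      + apply NNPP. intros Hne. apply Hno. exists n. congruence.
    - change (C_derive_n f 0 0%C) with (f 0%C). change (INR (fact 0)) with 1.
      change (z ^ 0)%C with (RtoC 1). field. }
  destruct Hn as [n Hn].
  set (c := Cmod (C_derive_n f (S n) 0 / RtoC (INR (fact (S n))))%C).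
  assert (Hfz : RtoC (INR (fact (S n))) <> 0%C).
  { intros E0. apply RtoC_inj in E0. now apply INR_fact_neq_0 in E0. }
  assert (Hc : 0 < c).
  { apply Cmod_gt_0. intros E. apply Hn.
    replace (C_derive_n f (S n) 0%C) with (C_derive_n f (S n) 0 / RtoC (INR (fact (S n))) * RtoC (INR (fact (S n))))%C
      by (field; exact Hfz).
    rewrite E. ring. }
  exists (Rmax 1 (exp 1 / c)). split; [apply Rmax_l|]. intros r Hr.
  assert (R1 : 1 < r) by (eapply Rle_lt_trans; [apply Rmax_l|exact Hr]).
  assert (R2 : exp 1 / c < r) by (eapply Rle_lt_trans; [apply Rmax_r|exact Hr]).
  assert (HM : c <= max_modulus f r / r ^ S n).
  { apply cauchy_estimate; [exact Hf|lra|]. intros h Hh. rewrite Cplus_0_l, <- Hh.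
    now apply max_modulus_ge. }
  assert (Pr : 0 < r ^ S n) by (apply pow_lt; lra).
  assert (H1 : c * r ^ S n <= max_modulus f r).
  { apply Rmult_le_compat_r with (r := r ^ S n) in HM; [|lra].
    unfold Rdiv in HM. rewrite Rmult_assoc, Rinv_l, Rmult_1_r in HM by lra. exact HM. }
  assert (H2 : r <= r ^ S n).
  { rewrite <- (pow_1 r) at 1. apply Rle_pow; [lra|lia]. }
  apply Rle_trans with (c * r).
  - apply Rmult_lt_compat_l with (r := c) in R2; [|exact Hc].
    replace (c * (exp 1 / c)) with (exp 1) in R2 by (field; lra). lra.
  - apply Rle_trans with (c * r ^ S n); [apply Rmult_le_compat_l; lra|exact H1].
Qed.

Lemma ln_ge_1 (x : R) : exp 1 <= x -> 1 <= ln x.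
Proof.
  intros H. rewrite <- (ln_exp 1). destruct H as [H|H].
  - left. apply ln_increasing; [apply exp_pos|exact H].
  - right. now rewrite H.
Qed.

Lemma ln_le (x y : R) : 0 < x -> x <= y -> ln x <= ln y.
Proof.
  intros Hx [H|H]; [left; now apply ln_increasing|right; now rewrite H].
Qed.

Lemma ln_pos (r : R) : 1 < r -> 0 < ln r.
Proof. intros H. rewrite <- ln_1. apply ln_increasing; lra. Qed.

Lemma order_nonneg (f : C -> C) : entire f -> Rbar_le (Finite 0) (order f).
Proof.
  intros Hf. unfold order. destruct (excluded_middle_informative _) as [_|Hnp].
  - apply Rbar_le_refl.
  - destruct (transcendental_max_modulus f Hf Hnp) as (r0 & Hr0 & HM).
    apply LimSup_infty_ge. intros a. exists (Rmax a r0 + 1).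
    pose proof (Rmax_l a r0). pose proof (Rmax_r a r0). split; [lra|].
    assert (Hr : r0 < Rmax a r0 + 1) by lra. set (r := Rmax a r0 + 1) in *.
    pose proof (ln_ge_1 _ (HM r ltac:(lra))) as H1.
    apply Rdiv_le_0_compat; [|apply ln_pos; lra].
    rewrite <- ln_1. apply ln_le; lra.
Qed.

Lemma order_transcendental (f : C -> C) : ~ is_polynomial f ->
  order f = LimSup_infty (fun r => ln (ln (max_modulus f r)) / ln r).
Proof. intros H. unfold order. now destruct (excluded_middle_informative _). Qed.

Lemma order_polynomial (f : C -> C) : is_polynomial f -> order f = Finite 0.
Proof. intros H. unfold order. now destruct (excluded_middle_informative _). Qed.

Lemma gaussian_small_ln (f : C -> C) (eps : R) : entire f -> ~ is_polynomial f ->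
  gaussian_small f -> 0 < eps ->
  exists r0, 1 <= r0 /\ forall r, r0 < r -> 1 <= ln (max_modulus f r) <= eps * r ^ 2.
Proof.
  intros Hf Hnp Hs He.
  destruct (transcendental_max_modulus f Hf Hnp) as (r0 & Hr0 & HM).
  destruct (Hs eps He) as (r1 & H1).
  exists (Rmax r0 r1). split; [eapply Rle_trans; [exact Hr0|apply Rmax_l]|]. intros r Hr.
  pose proof (Rmax_l r0 r1). pose proof (Rmax_r r0 r1).
  specialize (HM r ltac:(lra)). split; [now apply ln_ge_1|].
  rewrite <- (ln_exp (eps * r ^ 2)). apply ln_le; [eapply Rlt_le_trans; [apply exp_pos|exact HM]|].
  apply max_modulus_le; [exact Hf|lra|]. intros z Hz.
  rewrite <- Hz. apply H1. lra.
Qed.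

Lemma gaussian_small_order (f : C -> C) : entire f -> gaussian_small f ->
  Rbar_le (order f) (Finite 2).
Proof.
  intros Hf Hs. destruct (classic (is_polynomial f)) as [Hp|Hnp].
  - rewrite order_polynomial by exact Hp. cbn. lra.
  - rewrite order_transcendental by exact Hnp. apply LimSup_infty_le.
    destruct (gaussian_small_ln f 1 Hf Hnp Hs Rlt_0_1) as (r0 & Hr0 & H).
    exists r0. intros r Hr. specialize (H r Hr). rewrite Rmult_1_l in H.
    assert (Pl : 0 < ln r) by (apply ln_pos; lra).
    apply Rmult_le_reg_r with (ln r); [exact Pl|].
    unfold Rdiv. rewrite Rmult_assoc, Rinv_l, Rmult_1_r by lra.
    apply Rle_trans with (ln (r ^ 2)); [apply ln_le; lra|].
    cbn [pow]. rewrite Rmult_1_r, ln_mult by lra. lra.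
Qed.

Lemma Rpower_2 (r : R) : 0 < r -> Rpower r 2 = r ^ 2.
Proof. intros Hr. rewrite <- (Rpower_pow 2 r Hr). reflexivity. Qed.

Lemma gaussian_small_type (f : C -> C) : entire f -> gaussian_small f ->
  order f = Finite 2 -> growth_type f = Finite 0.
Proof.
  intros Hf Hs Ho.
  assert (Hnp : ~ is_polynomial f).
  { intros Hp. rewrite (order_polynomial f Hp) in Ho. injection Ho. lra. }
  unfold growth_type. rewrite Ho. cbn [real].
  apply Rbar_le_antisym.
  - assert (HE : forall eps, 0 < eps ->
      Rbar_le (LimSup_infty (fun r => ln (max_modulus f r) / Rpower r 2)) (Finite eps)).
    { intros eps He. apply LimSup_infty_le.
      destruct (gaussian_small_ln f eps Hf Hnp Hs He) as (r0 & Hr0 & H).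
      exists r0. intros r Hr. specialize (H r Hr). rewrite Rpower_2 by lra.
      assert (0 < r ^ 2) by (apply pow_lt; lra).
      apply Rmult_le_reg_r with (r ^ 2); [assumption|].
      unfold Rdiv. rewrite Rmult_assoc, Rinv_l, Rmult_1_r by lra. lra. }
    destruct (LimSup_infty _) as [l| |]; cbn.
    + apply le_of_eps. intros eps He. rewrite Rplus_0_l. exact (HE eps He).
    + exact (HE 1 Rlt_0_1).
    + exact I.
  - apply LimSup_infty_ge. intros a.
    destruct (gaussian_small_ln f 1 Hf Hnp Hs Rlt_0_1) as (r0 & Hr0 & H).
    exists (Rmax a r0 + 1). pose proof (Rmax_l a r0). pose proof (Rmax_r a r0). split; [lra|].
    specialize (H (Rmax a r0 + 1) ltac:(lra)).
    apply Rdiv_le_0_compat; [lra|]. unfold Rpower. apply exp_pos.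
Qed.

Lemma ln_bound_gaussian_small (f : C -> C) : entire f ->
  (forall eps, 0 < eps -> exists r0, forall r, r0 < r -> 0 < max_modulus f r /\ ln (max_modulus f r) <= eps * r ^ 2) ->
  gaussian_small f.
Proof.
  intros Hf H eps He. destruct (H eps He) as (r0 & Hr). exists r0. intros z Hz.
  destruct (Hr (Cmod z) Hz) as [HM Hl].
  eapply Rle_trans; [now apply max_modulus_ge|].
  rewrite <- (exp_ln _ HM) at 1. now apply exp_le.
Qed.

Lemma order_type_gaussian_small (f : C -> C) : entire f ->
  Rbar_le (order f) (Finite 2) -> (order f = Finite 2 -> growth_type f = Finite 0) ->
  gaussian_small f.
Proof.
  intros Hf Ho Ht. destruct (classic (is_polynomial f)) as [Hp|Hnp].
  { now apply polynomial_gaussian_small. }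
  destruct (transcendental_max_modulus f Hf Hnp) as (r0 & Hr0 & HM).
  apply ln_bound_gaussian_small; [exact Hf|]. intros eps He.
  pose proof (order_nonneg f Hf) as Hge.
  destruct (order f) as [rho| |] eqn:Eo; cbn in Ho, Hge; try contradiction.
  destruct (Req_dec rho 2) as [->|Hne].
  - specialize (Ht eq_refl). unfold growth_type in Ht. rewrite Eo in Ht. cbn [real] in Ht.
    destruct (LimSup_infty_lt (fun r => ln (max_modulus f r) / Rpower r 2) eps) as (a & Ha).
    { rewrite Ht. exact He. }
    exists (Rmax a r0). intros r Hr. pose proof (Rmax_l a r0). pose proof (Rmax_r a r0).
    specialize (HM r ltac:(lra)). split; [eapply Rlt_le_trans; [apply exp_pos|exact HM]|].
    specialize (Ha r ltac:(lra)). cbn beta in Ha. rewrite Rpower_2 in Ha by lra.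
    assert (0 < r ^ 2) by (apply pow_lt; lra).
    apply Rmult_le_compat_r with (r := r ^ 2) in Ha; [|lra].
    unfold Rdiv in Ha. rewrite Rmult_assoc, Rinv_l, Rmult_1_r in Ha by lra. exact Ha.
  - set (y := (rho + 2) / 2).
    rewrite (order_transcendental f Hnp) in Eo.
    destruct (LimSup_infty_lt (fun r => ln (ln (max_modulus f r)) / ln r) y) as (a & Ha).
    { rewrite Eo. cbn. unfold y. lra. }
    (* From [r >= b] on, [r ^ y <= eps * r ^ 2]. *)
    set (b := exp (- ln eps / (2 - y))).
    exists (Rmax (Rmax a b) r0). intros r Hr.
    pose proof (Rmax_l (Rmax a b) r0). pose proof (Rmax_r (Rmax a b) r0).
    pose proof (Rmax_l a b). pose proof (Rmax_r a b).
    specialize (HM r ltac:(lra)). split; [eapply Rlt_le_trans; [apply exp_pos|exact HM]|].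
    specialize (Ha r ltac:(lra)). cbn beta in Ha.
    pose proof (ln_ge_1 _ HM) as HL.
    assert (Pl : 0 < ln r) by (apply ln_pos; lra).
    apply Rmult_le_compat_r with (r := ln r) in Ha; [|lra].
    unfold Rdiv in Ha. rewrite Rmult_assoc, Rinv_l, Rmult_1_r in Ha by lra.
    assert (Hb : - ln eps / (2 - y) <= ln r).
    { rewrite <- (ln_exp (- ln eps / (2 - y))). apply ln_le; [apply exp_pos|fold b; lra]. }
    assert (Hy : 0 < 2 - y) by (unfold y; lra).
    apply Rmult_le_compat_r with (r := 2 - y) in Hb; [|lra].
    replace (- ln eps / (2 - y) * (2 - y)) with (- ln eps) in Hb by (field; lra).
    rewrite <- (exp_ln (ln (max_modulus f r))) by lra.
    rewrite <- (exp_ln (eps * r ^ 2)) by (apply Rmult_lt_0_compat; [lra|apply pow_lt; lra]).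
    apply exp_le. rewrite ln_mult by (try apply pow_lt; lra).
    replace (ln (r ^ 2)) with (2 * ln r) by (cbn [pow]; rewrite Rmult_1_r, ln_mult by lra; ring).
    lra.
Qed.

(** * Initial values of solutions of the heat equation *)

Lemma has_cderiv2_fst (F : C * C -> C) (t z l1 l2 : C) :
  has_cderiv2 F t z l1 l2 -> has_cderiv (fun s => F (s, z)) t l1.
Proof.
  intros H eps He. destruct (H eps He) as (d & Hd & HH). exists d. split; [exact Hd|].
  intros s Hs. specialize (HH s 0%C Hs ltac:(now rewrite Cmod_0)).
  rewrite Cplus_0_r, Cmod_0, Rplus_0_r in HH.
  now replace (F ((t + s)%C, z) - F (t, z) - s * l1 - 0 * l2)%C
    with (F ((t + s)%C, z) - F (t, z) - s * l1)%C in HH by ring.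
Qed.

Lemma has_cderiv2_snd (F : C * C -> C) (t z l1 l2 : C) :
  has_cderiv2 F t z l1 l2 -> has_cderiv (fun w => F (t, w)) z l2.
Proof.
  intros H eps He. destruct (H eps He) as (d & Hd & HH). exists d. split; [exact Hd|].
  intros h Hh. specialize (HH 0%C h ltac:(now rewrite Cmod_0) Hh).
  rewrite Cplus_0_r, Cmod_0, Rplus_0_l in HH.
  now replace (F (t, (z + h)%C) - F (t, z) - 0 * l1 - h * l2)%C
    with (F (t, (z + h)%C) - F (t, z) - h * l2)%C in HH by ring.
Qed.

Lemma has_cderiv2_locally_bounded (F : C * C -> C) (t z l1 l2 : C) :
  has_cderiv2 F t z l1 l2 -> exists rho M, 0 < rho /\
    forall s h, Cmod s <= rho -> Cmod h <= rho -> Cmod (F (t + s, z + h)%C) <= M.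
Proof.
  intros H. destruct (H 1 Rlt_0_1) as (d & Hd & HH).
  exists (d / 2), (d + d * Cmod l1 + d * Cmod l2 + Cmod (F (t, z))). split; [lra|].
  intros s h Hs Hh. specialize (HH s h ltac:(lra) ltac:(lra)).
  set (X := F (t + s, z + h)%C) in *.
  replace X with ((X - F (t, z) - s * l1 - h * l2) + (s * l1 + h * l2 + F (t, z)))%C by ring.
  eapply Rle_trans; [apply Cmod_triangle|].
  pose proof (Cmod_triangle (s * l1 + h * l2) (F (t, z))) as T1.
  pose proof (Cmod_triangle (s * l1) (h * l2)) as T2. rewrite !Cmod_mult in T2.
  pose proof (Cmod_ge_0 l1); pose proof (Cmod_ge_0 l2).
  assert (Cmod s * Cmod l1 <= d * Cmod l1) by (apply Rmult_le_compat_r; lra).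
  assert (Cmod h * Cmod l2 <= d * Cmod l2) by (apply Rmult_le_compat_r; lra).
  lra.
Qed.

Lemma fact_sqr_le (k : nat) : (fact k * fact k <= fact (2 * k))%nat.
Proof.
  induction k as [|k IH]; [cbn; lia|].
  replace (2 * S k)%nat with (S (S (2 * k))) by lia.
  rewrite !fact_simpl. pose proof (lt_O_fact k). nia.
Qed.

(** [k! / m <= 1 / k!] as soon as [(2 k)! <= m]; used with [m = (2 k)!] and
    [m = (2 k + 1)!]. *)
Lemma jet_ratio (k m : nat) (x y : R) : (fact (2 * k) <= m)%nat -> 0 <= y ->
  x <= INR (fact k) * y -> x / INR m <= y / INR (fact k).
Proof.
  intros Hm Hy Hx. pose proof (INR_fact_lt_0 k) as P1.
  pose proof (le_INR _ _ (fact_sqr_le k)) as S1. rewrite mult_INR in S1.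
  pose proof (le_INR _ _ Hm) as S2.
  assert (P2 : 0 < INR m) by (pose proof (INR_fact_lt_0 (2 * k)); lra).
  apply Rmult_le_reg_r with (INR m * INR (fact k)); [now apply Rmult_lt_0_compat|].
  replace (x / INR m * (INR m * INR (fact k))) with (x * INR (fact k)) by (field; lra).
  replace (y / INR (fact k) * (INR m * INR (fact k))) with (y * INR m) by (field; lra).
  apply Rle_trans with (INR (fact k) * y * INR (fact k)); [apply Rmult_le_compat_r; lra|].
  replace (INR (fact k) * y * INR (fact k)) with (y * (INR (fact k) * INR (fact k))) by ring.
  apply Rmult_le_compat_l; lra.
Qed.

Section Heat.
Context (F : C * C -> C) (HF : entire2 F) (Hheat : heat_equation F).

Lemma entire_time (z : C) : entire (fun s => F (s, z)).
Proof.
  apply entire_has_cderiv. intros t.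
  destruct (proj1 (entire2_has_cderiv2 F) HF t z) as (l1 & l2 & H).
  exists l1. now apply (has_cderiv2_fst F t z l1 l2).
Qed.

Lemma entire_space (t : C) : entire (fun w => F (t, w)).
Proof.
  apply entire_has_cderiv. intros z.
  destruct (proj1 (entire2_has_cderiv2 F) HF t z) as (l1 & l2 & H).
  exists l2. now apply (has_cderiv2_snd F t z l1 l2).
Qed.

Definition space_jet (n : nat) (t : C) : C := C_derive_n (fun w => F (t, w)) n 0%C.

(** The function
    [D w = F (t + s, w) - F (t, w) - s * d_z^2 F (t, w)]
    is entire in [w], and by the heat equation it is the first-order remainder
    in time, hence [O (s^2)] uniformly on a circle around 0.  Cauchy's estimate
    for the [n]-th derivative of [D] at 0 then says that the time derivative of
    the [n]-th jet is the [(n+2)]-th one.  This avoids exchanging time and space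
    derivatives. *)
Lemma space_jet_cderiv (n : nat) (t : C) : has_cderiv (space_jet n) t (space_jet (S (S n)) t).
Proof.
  destruct (proj1 (entire2_has_cderiv2 F) HF t 0%C) as (l1 & l2 & H).
  destruct (has_cderiv2_locally_bounded _ _ _ _ _ H) as (rho & M & Hrho & HM).
  apply (quadratic_cderiv _ _ _ (INR (fact n) * (2 * M / (rho * rho) / rho ^ n)) (rho / 2)); [lra|].
  intros s Hs.
  set (g := fun w => F (t, w)). set (k := fun w => F ((t + s)%C, w)).
  assert (Hg : entire g) by apply entire_space. assert (Hk : entire k) by apply entire_space.
  set (D := fun w => (k w - g w - s * C_derive_n g 2 w)%C).
  assert (HD : entire D) by (apply entire_lin3; [exact Hk|exact Hg|now apply entire_C_derive_n]).
  assert (HB : Cmod (C_derive_n D n 0 / RtoC (INR (fact n)))%C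
     <= 2 * M / (rho * rho) * (Cmod s * Cmod s) / rho ^ n).
  { apply cauchy_estimate; [exact HD|exact Hrho|]. intros w Hw. rewrite Cplus_0_l.
    unfold D, g, k. rewrite <- Hheat.
    apply (cauchy_first_order (fun u => F (u, w)) t rho M); [apply entire_time|exact Hrho| |exact Hs].
    intros u Hu. rewrite <- (Cplus_0_l w). apply HM; lra. }
  assert (ED : C_derive_n D n 0%C = (space_jet n (t + s) - space_jet n t - s * space_jet (S (S n)) t)%C).
  { unfold D. rewrite C_derive_n_lin3; [|exact Hk|exact Hg|now apply entire_C_derive_n].
    unfold space_jet. fold g k. rewrite <- C_derive_n_add.
    replace (n + 2)%nat with (S (S n)) by lia. reflexivity. }
  rewrite <- ED.
  replace (C_derive_n D n 0%C) with (RtoC (INR (fact n)) * (C_derive_n D n 0 / RtoC (INR (fact n))))%C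
    by (field; apply INR_fact_C_nz).
  rewrite Cmod_mult, Cmod_R, Rabs_pos_eq by apply pos_INR.
  replace (INR (fact n) * (2 * M / (rho * rho) / rho ^ n) * (Cmod s * Cmod s)) with
    (INR (fact n) * (2 * M / (rho * rho) * (Cmod s * Cmod s) / rho ^ n)).
  - apply Rmult_le_compat_l; [apply pos_INR|exact HB].
  - field. repeat split; try apply pow_nonzero; lra.
Qed.

Lemma entire_space_jet (n : nat) : entire (space_jet n).
Proof. apply entire_has_cderiv. intros t. eexists. apply space_jet_cderiv. Qed.

Lemma C_derive_n_space_jet (n k : nat) : C_derive_n (space_jet n) k = space_jet (2 * k + n).
Proof.
  induction k as [|k IH]; [reflexivity|].
  apply functional_extensionality. intros t.
  change (C_derive (C_derive_n (space_jet n) k) t = space_jet (2 * S k + n) t).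
  rewrite IH. replace (2 * S k + n)%nat with (S (S (2 * k + n))) by lia.
  apply C_derive_eq, space_jet_cderiv.
Qed.

Lemma space_jet_bound (n : nat) (T : R) : 0 < T ->
  exists M, 0 < M /\ forall k, Cmod (space_jet (2 * k + n) 0) <= INR (fact k) * (M / T ^ k).
Proof.
  intros HT. destruct (entire_bounded (space_jet n) 0%C T (entire_space_jet n) HT) as (M & HM & Hb).
  exists M. split; [exact HM|]. intros k.
  assert (H : Cmod (C_derive_n (space_jet n) k 0 / RtoC (INR (fact k)))%C <= M / T ^ k).
  { apply cauchy_estimate; [apply entire_space_jet|exact HT|]. intros h Hh. apply Hb. lra. }
  rewrite C_derive_n_space_jet in H.
  replace (space_jet (2 * k + n) 0%C) with
    (RtoC (INR (fact k)) * (space_jet (2 * k + n) 0 / RtoC (INR (fact k))))%C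
    by (field; apply INR_fact_C_nz).
  rewrite Cmod_mult, Cmod_R, Rabs_pos_eq by apply pos_INR.
  apply Rmult_le_compat_l; [apply pos_INR|exact H].
Qed.

(** Even and odd Taylor coefficients are both bounded by [M / (T^k k!)], where
    [k] is half the index; the two exponential series add up to the factor
    [1 + |z|]. *)
Lemma heat_initial_bound (T : R) : 0 < T ->
  exists M, 0 < M /\ forall z,
    Cmod (F (RtoC 0, z)) <= M * (1 + Cmod z) * exp (Cmod z ^ 2 / T).
Proof.
  intros HT.
  destruct (space_jet_bound 0 T HT) as (M0 & HM0 & H0).
  destruct (space_jet_bound 1 T HT) as (M1 & HM1 & H1).
  set (M := M0 + M1). exists M. split; [unfold M; lra|]. intros z.
  set (a := fun n => M / T ^ Nat.div2 n / INR (fact (Nat.div2 n))).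
  set (r := Cmod z). assert (Pr : 0 <= r) by apply Cmod_ge_0.
  assert (Hexp : is_pseries (fun k => M / T ^ k / INR (fact k)) (r ^ 2) (M * exp (r ^ 2 / T))).
  { pose proof (is_exp_Reals (r ^ 2 / T)) as He.
    apply (is_series_scal (V := R_NormedModule) M) in He.
    eapply is_series_ext; [|exact He]. intros k.
    change (M * (pow_n (r ^ 2 / T) k * / INR (fact k)) = pow_n (r ^ 2) k * (M / T ^ k / INR (fact k))).
    rewrite (pow_n_pow (r ^ 2 / T)), (pow_n_pow (r ^ 2)). unfold Rdiv.
    rewrite Rpow_mult_distr, pow_inv. ring. }
  assert (Hs : is_pseries a r (M * exp (r ^ 2 / T) + r * (M * exp (r ^ 2 / T)))).
  { apply is_pseries_odd_even.
    - eapply is_series_ext; [|exact Hexp]. intros k. unfold a. now rewrite Nat.div2_double.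
    - eapply is_series_ext; [|exact Hexp]. intros k. unfold a.
      rewrite Nat.add_1_r, Nat.div2_succ_double. reflexivity. }
  replace (M * (1 + r) * exp (r ^ 2 / T)) with (M * exp (r ^ 2 / T) + r * (M * exp (r ^ 2 / T))) by ring.
  pose proof (taylor (fun w => F (RtoC 0, w)) 0%C z (entire_space _)) as Ht.
  cbv beta in Ht. rewrite Cplus_0_l in Ht.
  refine (is_series_Cmod_le _ _ _ _ _ Hs Ht).
  intros n. rewrite Cmod_mult, Cmod_pow. fold r.
  change (Cmod (space_jet n 0 / RtoC (INR (fact n)))%C * r ^ n <= pow_n r n * a n).
  replace (pow_n r n * a n) with (a n * r ^ n) by (rewrite Rmult_comm; f_equal; symmetry; apply pow_n_pow).
  apply Rmult_le_compat_r; [now apply pow_le|].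
  rewrite Cmod_div by apply INR_fact_C_nz. rewrite Cmod_R, Rabs_pos_eq by apply pos_INR.
  assert (PT : forall k, 0 < / T ^ k) by (intros k; apply Rinv_0_lt_compat, pow_lt, HT).
  assert (HMk : forall k, M0 / T ^ k <= M / T ^ k /\ M1 / T ^ k <= M / T ^ k /\ 0 <= M / T ^ k).
  { intros k. specialize (PT k). unfold M, Rdiv. repeat split; nra. }
  destruct (Nat.Even_or_Odd n) as [[k ->]|[k ->]]; unfold a.
  - rewrite Nat.div2_double. destruct (HMk k) as (A1 & A2 & A3).
    apply jet_ratio; [lia|exact A3|].
    specialize (H0 k). rewrite Nat.add_0_r in H0. eapply Rle_trans; [exact H0|].
    apply Rmult_le_compat_l; [apply pos_INR|exact A1].
  - replace (Nat.div2 (2 * k + 1)) with k by (rewrite Nat.add_1_r, Nat.div2_succ_double; reflexivity).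
    destruct (HMk k) as (A1 & A2 & A3).
    apply jet_ratio; [apply fact_le; lia|exact A3|].
    eapply Rle_trans; [exact (H1 k)|].
    apply Rmult_le_compat_l; [apply pos_INR|exact A2].
Qed.

Lemma heat_initial_gaussian_small : gaussian_small (fun z => F (RtoC 0, z)).
Proof.
  intros eps He. assert (HT : 0 < 2 / eps) by (apply Rdiv_lt_0_compat; lra).
  destruct (heat_initial_bound _ HT) as (M & HM & Hb).
  (* With [T = 2 / eps] half of [eps] serves the Gaussian factor; the other half
     absorbs [M * (1 + r) <= exp (2 * r)]. *)
  exists (Rmax M (4 / eps)). intros z Hz.
  assert (Z1 : M < Cmod z) by (eapply Rle_lt_trans; [apply Rmax_l|exact Hz]).
  assert (Z2 : 4 / eps < Cmod z) by (eapply Rle_lt_trans; [apply Rmax_r|exact Hz]).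
  assert (Z3 : 4 <= eps * Cmod z).
  { apply Rmult_lt_compat_l with (r := eps) in Z2; [|exact He].
    replace (eps * (4 / eps)) with 4 in Z2 by (field; lra). lra. }
  eapply Rle_trans; [apply Hb|]. set (r := Cmod z) in *.
  replace (r ^ 2 / (2 / eps)) with (eps / 2 * r ^ 2) by (field; lra).
  pose proof (exp_ineq1 r ltac:(lra)) as E1.
  apply Rle_trans with (exp r * exp r * exp (eps / 2 * r ^ 2)).
  - apply Rmult_le_compat_r; [left; apply exp_pos|].
    apply Rmult_le_compat; lra.
  - rewrite <- !exp_plus. apply exp_le. nra.
Qed.

End Heat.

(** * The solution with a given initial value *)

Lemma has_cderiv_scal (c : C) (g : C -> C) (w l : C) :
  has_cderiv g w l -> has_cderiv (fun z => c * g z)%C w (c * l)%C.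
Proof.
  intros H eps He. pose proof (Cmod_ge_0 c) as Pc.
  destruct (H (eps / (Cmod c + 1))) as (d & Hd & K); [apply Rdiv_lt_0_compat; lra|].
  exists d. split; [exact Hd|]. intros h Hh. specialize (K h Hh).
  replace (c * g (w + h) - c * g w - h * (c * l))%C with (c * (g (w + h) - g w - h * l))%C by ring.
  rewrite Cmod_mult.
  apply Rle_trans with ((Cmod c + 1) * (eps / (Cmod c + 1) * Cmod h)).
  - apply Rmult_le_compat; [exact Pc|apply Cmod_ge_0|lra|exact K].
  - right. field. lra.
Qed.

Lemma entire_scal (c : C) (g : C -> C) : entire g -> entire (fun z => c * g z)%C.
Proof.
  intros Hg. apply entire_has_cderiv. intros w. eexists.
  apply has_cderiv_scal. now apply entire_C_derive.
Qed.

Lemma C_derive_scal (c : C) (g : C -> C) : entire g ->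
  C_derive (fun z => c * g z)%C = fun z => (c * C_derive g z)%C.
Proof.
  intros Hg. apply functional_extensionality. intros w.
  apply C_derive_eq, has_cderiv_scal. now apply entire_C_derive.
Qed.

(** The Weierstrass test on every disc about 0. *)
Definition locally_summable (u : nat -> C -> C) : Prop :=
  forall r, 0 < r -> exists b, ex_series b /\ forall j z, Cmod z <= r -> Cmod (u j z) <= b j.

(** The derivatives satisfy the same hypotheses as the terms, so the lemma can be
    iterated. *)
Lemma series_entire (u : nat -> C -> C) (S : C -> C) :
  (forall j, entire (u j)) -> locally_summable u -> (forall z, cseries (fun j => u j z) (S z)) ->
  entire S /\ locally_summable (fun j => C_derive (u j)) /\
  forall z, cseries (fun j => C_derive (u j) z) (C_derive S z).
Proof.
  intros Hu Hs HS.
  assert (K : forall z r, Cmod z <= r -> forall b, ex_series b ->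
     (forall j z, Cmod z <= r + 1 -> Cmod (u j z) <= b j) ->
     (forall j, Cmod (C_derive (u j) z) <= b j / 1) /\
     exists l : C, cseries (fun j => C_derive (u j) z) l /\ has_cderiv S z l).
  { intros z r Hz b Hb Hub. apply series_cderiv; [exact Hu|lra|exact Hb| |].
    - intros j h Hh. apply Hub. pose proof (Cmod_triangle z h). lra.
    - intros h _. apply HS. }
  split; [|split].
  - apply entire_has_cderiv. intros z. pose proof (Cmod_ge_0 z).
    destruct (Hs (Cmod z + 1) ltac:(lra)) as (b & Hb & Hub).
    destruct (K z (Cmod z) (Rle_refl _) b Hb Hub) as (_ & l & _ & Hl). now exists l.
  - intros r Hr. destruct (Hs (r + 1) ltac:(lra)) as (b & Hb & Hub).
    exists b. split; [exact Hb|]. intros j z Hz.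
    rewrite <- (Rdiv_1_r (b j)). now apply (K z r Hz b Hb Hub).
  - intros z. pose proof (Cmod_ge_0 z).
    destruct (Hs (Cmod z + 1) ltac:(lra)) as (b & Hb & Hub).
    destruct (K z (Cmod z) (Rle_refl _) b Hb Hub) as (_ & l & Hl & Hd).
    now rewrite (C_derive_eq _ _ _ Hd).
Qed.

Lemma gaussian_small_global (f : C -> C) (eps : R) : entire f -> gaussian_small f -> 0 < eps ->
  exists K, 0 < K /\ forall z, Cmod (f z) <= K * exp (eps * Cmod z ^ 2).
Proof.
  intros Hf Hs He. destruct (Hs eps He) as (r0 & Hr0).
  pose proof (Rabs_pos r0). pose proof (Rle_abs r0).
  destruct (entire_bounded f 0%C (Rabs r0 + 1) Hf ltac:(lra)) as (M & HM & Hb).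
  exists (M + 1). split; [lra|]. intros z.
  pose proof (exp_pos (eps * Cmod z ^ 2)).
  destruct (Rlt_le_dec r0 (Cmod z)) as [Hz|Hz].
  - eapply Rle_trans; [now apply Hr0|]. nra.
  - assert (1 <= exp (eps * Cmod z ^ 2)).
    { rewrite <- exp_0. apply exp_le. apply Rmult_le_pos; [lra|]. apply pow_le, Cmod_ge_0. }
    pose proof (Hb z ltac:(lra)) as Hz2. rewrite Cplus_0_l in Hz2. nra.
Qed.

Lemma fact_double_le (j : nat) : (fact (2 * j) <= 4 ^ j * (fact j * fact j))%nat.
Proof.
  induction j as [|j IH]; [cbn; lia|].
  replace (2 * S j)%nat with (S (S (2 * j))) by lia.
  rewrite !fact_simpl, Nat.pow_succ_r'. nia.
Qed.

Lemma fact_le_pow (j : nat) : (fact j <= j ^ j)%nat.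
Proof.
  induction j as [|j IH]; [cbn; lia|].
  rewrite fact_simpl, Nat.pow_succ_r'.
  assert (j ^ j <= S j ^ j)%nat by (apply Nat.pow_le_mono_l; lia). nia.
Qed.

Lemma exp_INR_le (j : nat) : exp (INR j) <= 3 ^ j.
Proof.
  induction j as [|j IH]; [cbn; rewrite exp_0; lra|].
  rewrite S_INR, exp_plus. cbn [pow]. rewrite Rmult_comm.
  apply Rmult_le_compat; [left; apply exp_pos|left; apply exp_pos|apply exp_le_3|exact IH].
Qed.

Lemma geometric_half (B : R) : is_series (fun j => B * (/ 2) ^ j) (B * 2).
Proof.
  replace (B * 2) with (B * / (1 - / 2)) by field.
  apply (is_series_scal (V := R_NormedModule) B (fun j => (/ 2) ^ j)). apply is_series_geom.
  rewrite Rabs_pos_eq; lra.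
Qed.

Section Converse.
Context (f : C -> C) (Hf : entire f) (Hs : gaussian_small f).

Definition heat_coef (j : nat) (z : C) : C := (C_derive_n f (2 * j) z / RtoC (INR (fact j)))%C.

(** Cauchy's estimate on the circle of radius [sqrt x] bounds
    [|f^(2 n) z| / (2 n)!] by a constant times [exp (2 eps x) / x^n], which is
    smallest at [x = n / (2 eps)]; the factor [(2 n)! / n!] is at most
    [(4 n)^n], so the result is geometric with ratio a multiple of [eps]. *)
Lemma heat_coef_bound (T r : R) : 0 < T -> 0 < r ->
  exists B, 0 < B /\ forall j z, Cmod z <= r -> Cmod (heat_coef j z) <= B / (2 * T) ^ j.
Proof.
  intros HT Hr.
  (* With this [eps] the ratio [24 eps] of the geometric bound is [1 / (2 T)]. *)
  set (eps := / (48 * T)). assert (He : 0 < eps) by (apply Rinv_0_lt_compat; lra).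
  destruct (gaussian_small_global f eps Hf Hs He) as (K & HK & HKb).
  set (B := K * exp (2 * eps * r ^ 2)).
  assert (HB : 0 < B) by (apply Rmult_lt_0_compat; [exact HK|apply exp_pos]).
  exists B. split; [exact HB|]. intros j z Hz. pose proof (Cmod_ge_0 z) as Pz.
  assert (Hz2 : Cmod z ^ 2 <= r ^ 2) by (apply pow_incr; lra).
  destruct j as [|j].
  { unfold heat_coef. change (C_derive_n f (2 * 0) z) with (f z). change (INR (fact 0)) with 1.
    replace (f z / 1)%C with (f z) by field. rewrite pow_O, Rdiv_1_r.
    eapply Rle_trans; [apply HKb|]. apply Rmult_le_compat_l; [lra|]. apply exp_le.
    assert (0 <= r ^ 2) by (apply pow_le; lra). nra. }
  set (n := S j). assert (Hn : 0 < INR n) by (apply lt_0_INR; unfold n; lia).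
  (* [x = n / (2 eps)] *)
  set (x := 24 * T * INR n). assert (Hx : 0 < x) by (unfold x; apply Rmult_lt_0_compat; lra).
  set (rho := sqrt x). assert (Hrho : 0 < rho) by (apply sqrt_lt_R0; exact Hx).
  assert (Erho : rho ^ 2 = x) by (unfold rho; rewrite pow2_sqrt; lra).
  assert (HC : Cmod (C_derive_n f (2 * n) z / RtoC (INR (fact (2 * n))))%C <= B * 3 ^ n / rho ^ (2 * n)).
  { apply cauchy_estimate; [exact Hf|exact Hrho|]. intros h Hh.
    eapply Rle_trans; [apply HKb|].
    unfold B. rewrite Rmult_assoc. apply Rmult_le_compat_l; [lra|].
    apply Rle_trans with (exp (2 * eps * r ^ 2) * exp (INR n)).
    - rewrite <- exp_plus. apply exp_le.
      pose proof (Cmod_triangle z h) as Ht. pose proof (Cmod_ge_0 (z + h)%C).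
      assert (A1 : Cmod (z + h)%C ^ 2 <= 2 * Cmod z ^ 2 + 2 * rho ^ 2).
      { rewrite Hh in Ht. apply Rle_trans with ((Cmod z + rho) ^ 2); [apply pow_incr; lra|].
        pose proof (pow2_ge_0 (Cmod z - rho)). cbn [pow] in *. lra. }
      rewrite Erho in A1.
      assert (A2 : eps * (2 * x) = INR n) by (unfold eps, x; field; lra).
      apply Rle_trans with (eps * (2 * r ^ 2 + 2 * x)); [apply Rmult_le_compat_l; lra|lra].
    - apply Rmult_le_compat_l; [left; apply exp_pos|apply exp_INR_le]. }
  rewrite pow_mult, Erho in HC.
  unfold heat_coef.
  replace (C_derive_n f (2 * n) z / RtoC (INR (fact n)))%C with
    ((C_derive_n f (2 * n) z / RtoC (INR (fact (2 * n)))) * (RtoC (INR (fact (2 * n))) / RtoC (INR (fact n))))%C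
    by (field; split; apply INR_fact_C_nz).
  rewrite Cmod_mult, (Cmod_div (RtoC (INR (fact (2 * n))))) by apply INR_fact_C_nz.
  rewrite !Cmod_R, !(Rabs_pos_eq (INR _)) by apply pos_INR.
  assert (Hq : INR (fact (2 * n)) / INR (fact n) <= 4 ^ n * INR n ^ n).
  { pose proof (INR_fact_lt_0 n) as P1.
    apply Rmult_le_reg_r with (INR (fact n)); [exact P1|].
    unfold Rdiv. rewrite Rmult_assoc, Rinv_l, Rmult_1_r by lra.
    pose proof (le_INR _ _ (fact_double_le n)) as Q1. rewrite !mult_INR, pow_INR in Q1.
    pose proof (le_INR _ _ (fact_le_pow n)) as Q2. rewrite pow_INR in Q2.
    replace (INR 4) with 4 in Q1 by (cbn; lra).
    eapply Rle_trans; [exact Q1|]. rewrite <- Rmult_assoc.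
    apply Rmult_le_compat_r; [lra|]. apply Rmult_le_compat_l; [apply pow_le; lra|exact Q2]. }
  apply Rle_trans with (B * 3 ^ n / x ^ n * (4 ^ n * INR n ^ n)).
  - apply Rmult_le_compat; [apply Cmod_ge_0| |exact HC|exact Hq].
    apply Rdiv_le_0_compat; [apply pos_INR|apply INR_fact_lt_0].
  - right. unfold x.
    replace (24 * T * INR n) with (3 * 4 * (2 * T) * INR n) by ring.
    rewrite !Rpow_mult_distr. field.
    repeat split; apply pow_nonzero; lra.
Qed.

Lemma heat_coef_entire (j : nat) : entire (heat_coef j).
Proof.
  unfold heat_coef.
  replace (fun z => C_derive_n f (2 * j) z / RtoC (INR (fact j)))%C
    with (fun z => / RtoC (INR (fact j)) * C_derive_n f (2 * j) z)%C.
  - apply entire_scal, entire_C_derive_n, Hf.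
  - apply functional_extensionality. intros z. unfold Cdiv. ring.
Qed.

(** This is the heat equation, term by term. *)
Lemma C_derive2_heat_coef (j : nat) (z : C) :
  C_derive_n (heat_coef j) 2 z = deriv_coef (fun i => heat_coef i z) j.
Proof.
  unfold deriv_coef, heat_coef. cbv beta.
  replace (fun z => C_derive_n f (2 * j) z / RtoC (INR (fact j)))%C
    with (fun z => / RtoC (INR (fact j)) * C_derive_n f (2 * j) z)%C.
  2:{ apply functional_extensionality. intros w. unfold Cdiv. ring. }
  change (C_derive (C_derive (fun z => / RtoC (INR (fact j)) * C_derive_n f (2 * j) z)%C) z =
    RtoC (INR (S j)) * (C_derive_n f (2 * S j) z / RtoC (INR (fact (S j)))))%C.
  rewrite C_derive_scal by now apply entire_C_derive_n.
  rewrite C_derive_scal by (apply entire_C_derive_entire; now apply entire_C_derive_n).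
  replace (2 * S j)%nat with (S (S (2 * j))) by lia.
  change (C_derive_n f (S (S (2 * j))) z) with (C_derive (C_derive (C_derive_n f (2 * j))) z).
  rewrite fact_simpl, mult_INR, RtoC_mult. field.
  split; [apply INR_fact_C_nz|].
  intros E. apply RtoC_inj in E. rewrite S_INR in E. pose proof (pos_INR j). lra.
Qed.

Lemma heat_term_bound (T r : R) : 0 < T -> 0 < r ->
  exists B, 0 < B /\ forall j t z, Cmod t <= T -> Cmod z <= r ->
    Cmod (heat_coef j z * t ^ j)%C <= B * (/ 2) ^ j.
Proof.
  intros HT Hr. destruct (heat_coef_bound T r HT Hr) as (B & HB & Hb).
  exists B. split; [exact HB|]. intros j t z Ht Hz. rewrite Cmod_mult, Cmod_pow.
  apply Rle_trans with (B / (2 * T) ^ j * T ^ j).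
  - apply Rmult_le_compat; [apply Cmod_ge_0|apply pow_le, Cmod_ge_0|now apply Hb|].
    apply pow_incr. split; [apply Cmod_ge_0|exact Ht].
  - right. rewrite Rpow_mult_distr, pow_inv. field. split; apply pow_nonzero; lra.
Qed.

Definition heat_solution (p : C * C) : C :=
  epsilon (inhabits (RtoC 0)) (fun l => cseries (fun j => heat_coef j (snd p) * fst p ^ j)%C l).

Lemma heat_solution_series (t z : C) :
  cseries (fun j => heat_coef j z * t ^ j)%C (heat_solution (t, z)).
Proof.
  apply (epsilon_spec (inhabits (RtoC 0)) (fun l => cseries (fun j => heat_coef j z * t ^ j)%C l)).
  pose proof (Cmod_ge_0 t); pose proof (Cmod_ge_0 z).
  destruct (heat_term_bound (Cmod t + 1) (Cmod z + 1)) as (B & _ & HB); [lra|lra|].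
  apply (ex_series_Cmod_le _ (fun j => B * (/ 2) ^ j)).
  - intros j. apply HB; lra.
  - eexists. apply geometric_half.
Qed.

Lemma heat_solution_bound (T r : R) : 0 < T -> 0 < r ->
  exists M, forall t z, Cmod t <= T -> Cmod z <= r -> Cmod (heat_solution (t, z)) <= M.
Proof.
  intros HT Hr. destruct (heat_term_bound T r HT Hr) as (B & _ & HB).
  exists (B * 2). intros t z Ht Hz.
  refine (is_series_Cmod_le _ _ _ _ _ (geometric_half B) (heat_solution_series t z)).
  intros j. now apply HB.
Qed.

Lemma heat_solution_space (t : C) :
  entire (fun w => heat_solution (t, w)) /\
  forall z, cseries (fun j => deriv_coef (fun i => heat_coef i z) j * t ^ j)%C
     (C_derive_n (fun w => heat_solution (t, w)) 2 z).
Proof.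
  set (u := fun j z => (t ^ j * heat_coef j z)%C).
  assert (Hu : forall j, entire (u j)) by (intros j; apply entire_scal, heat_coef_entire).
  assert (HS : forall z, cseries (fun j => u j z) (heat_solution (t, z))).
  { intros z. eapply cseries_ext; [|apply heat_solution_series]. intros j. unfold u. ring. }
  assert (Hl : locally_summable u).
  { intros r Hr. pose proof (Cmod_ge_0 t).
    destruct (heat_term_bound (Cmod t + 1) r) as (B & _ & HB); [lra|exact Hr|].
    exists (fun j => B * (/ 2) ^ j). split; [eexists; apply geometric_half|].
    intros j z Hz. unfold u. rewrite Cmult_comm. apply HB; lra. }
  destruct (series_entire u (fun w => heat_solution (t, w)) Hu Hl HS) as (E1 & L1 & S1).
  destruct (series_entire (fun j => C_derive (u j)) (C_derive (fun w => heat_solution (t, w)))) as (_ & _ & S2).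
  { intros j. now apply entire_C_derive_entire. }
  { exact L1. }
  { exact S1. }
  split; [exact E1|]. intros z. eapply cseries_ext; [|apply (S2 z)]. intros j. cbv beta.
  unfold u. rewrite C_derive_scal by apply heat_coef_entire.
  rewrite C_derive_scal by (apply entire_C_derive_entire, heat_coef_entire).
  rewrite <- C_derive2_heat_coef. unfold C_derive_n at 1. cbn. apply Cmult_comm.
Qed.

Lemma heat_solution_time (z t : C) :
  has_cderiv (fun s => heat_solution (s, z)) t (C_derive (fun s => heat_solution (s, z)) t) /\
  cseries (fun j => deriv_coef (fun i => heat_coef i z) j * t ^ j)%C
     (C_derive (fun s => heat_solution (s, z)) t).
Proof.
  pose proof (Cmod_ge_0 t); pose proof (Cmod_ge_0 z).
  destruct (heat_coef_bound (Cmod t + 1) (Cmod z + 1)) as (B & _ & HB); [lra|lra|].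
  apply (power_series_cderiv (fun i => heat_coef i z) (fun s => heat_solution (s, z)) B
     (2 * (Cmod t + 1)) t).
  - lra.
  - intros j. apply HB. lra.
  - intros h _. apply heat_solution_series.
  - lra.
Qed.

Lemma heat_solution_heat : heat_equation heat_solution.
Proof.
  intros t z.
  exact (is_series_C_unique _ _ _ (proj2 (heat_solution_time z t)) (proj2 (heat_solution_space t) z)).
Qed.

Lemma heat_solution_entire_time (z : C) : entire (fun s => heat_solution (s, z)).
Proof. apply entire_has_cderiv. intros t. eexists. apply heat_solution_time. Qed.

(** The increment of [F] is split as
    [F (t+s, z+h) - F (t, z+h) - s * d_t F (t, z+h)], plus
    [s * (d_t F (t, z+h) - d_t F (t, z))], plus the increment in [z] alone.  The
    first part is [O (s^2)] uniformly in [h]; the second is [o (s)] because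
    [d_t F (t, .) = d_z^2 F (t, .)] is entire, hence continuous. *)
Lemma heat_solution_entire2 : entire2 heat_solution.
Proof.
  apply entire2_has_cderiv2. intros t z.
  exists (C_derive (fun s => heat_solution (s, z)) t), (C_derive (fun w => heat_solution (t, w)) z).
  intros eps He.
  pose proof (Cmod_ge_0 t); pose proof (Cmod_ge_0 z).
  destruct (heat_solution_bound (Cmod t + 1) (Cmod z + 1)) as (M & HM); [lra|lra|].
  assert (Hdt : entire (fun w => C_derive (fun s => heat_solution (s, w)) t)).
  { replace (fun w => C_derive (fun s => heat_solution (s, w)) t)
      with (C_derive_n (fun w => heat_solution (t, w)) 2).
    - apply entire_C_derive_n. apply heat_solution_space.
    - apply functional_extensionality. intros w. symmetry. apply heat_solution_heat. }
  set (Dt := fun w => C_derive (fun s => heat_solution (s, w)) t) in *.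
  destruct (has_cderiv_cont _ _ _ (entire_C_derive _ z Hdt) (eps / 2)) as (d1 & Hd1 & K1); [lra|].
  destruct (entire_C_derive _ z (proj1 (heat_solution_space t)) (eps / 2)) as (d2 & Hd2 & K2); [lra|].
  pose proof (Rabs_pos (2 * M)) as PM.
  set (d3 := eps / (2 * (Rabs (2 * M) + 1))).
  assert (Hd3 : 0 < d3) by (apply Rdiv_lt_0_compat; lra).
  exists (Rmin (Rmin (1 / 2) d3) (Rmin d1 d2)).
  split; [repeat apply Rmin_pos; lra|]. intros s h Hs' Hh.
  pose proof (Rmin_l (Rmin (1 / 2) d3) (Rmin d1 d2)). pose proof (Rmin_r (Rmin (1 / 2) d3) (Rmin d1 d2)).
  pose proof (Rmin_l (1 / 2) d3). pose proof (Rmin_r (1 / 2) d3).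
  pose proof (Rmin_l d1 d2). pose proof (Rmin_r d1 d2).
  specialize (K1 h ltac:(lra)). specialize (K2 h ltac:(lra)).
  destruct (cauchy_first_order (fun s => heat_solution (s, (z + h)%C)) t 1 M) as (_ & K3).
  { apply heat_solution_entire_time. }
  { lra. }
  { intros k Hk. apply HM.
    - pose proof (Cmod_triangle t k). lra.
    - pose proof (Cmod_triangle z h). lra. }
  specialize (K3 s ltac:(lra)). cbv beta in K3, K2.
  fold (Dt (z + h)%C) in K3. fold (Dt z).
  set (A := heat_solution (t + s, z + h)%C) in *. set (A1 := heat_solution (t, z + h)%C) in *.
  set (A2 := heat_solution (t, z)) in *. set (E := C_derive (fun w => heat_solution (t, w)) z) in *.
  replace (A - A2 - s * Dt z - h * E)%C with
    ((A - A1 - s * Dt (z + h)) + (s * (Dt (z + h) - Dt z) + (A1 - A2 - h * E)))%C by ring.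
  pose proof (Cmod_triangle (A - A1 - s * Dt (z + h)%C)%C (s * (Dt (z + h)%C - Dt z) + (A1 - A2 - h * E))%C) as T1.
  pose proof (Cmod_triangle (s * (Dt (z + h)%C - Dt z))%C (A1 - A2 - h * E)%C) as T2.
  rewrite Cmod_mult in T2.
  pose proof (Cmod_ge_0 s) as Ps.
  assert (T3 : Cmod s * Cmod (Dt (z + h) - Dt z)%C <= Cmod s * (eps / 2)) by (apply Rmult_le_compat_l; lra).
  assert (T4 : 2 * M / (1 * 1) * (Cmod s * Cmod s) <= eps / 2 * Cmod s).
  { replace (2 * M / (1 * 1) * (Cmod s * Cmod s)) with (2 * M * Cmod s * Cmod s) by field.
    apply Rmult_le_compat_r; [exact Ps|].
    apply Rle_trans with ((Rabs (2 * M) + 1) * d3).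
    - apply Rle_trans with ((Rabs (2 * M) + 1) * Cmod s).
      + apply Rmult_le_compat_r; [exact Ps|]. pose proof (Rle_abs (2 * M)). lra.
      + apply Rmult_le_compat_l; lra.
    - right. unfold d3. field. lra. }
  pose proof (Rle_trans _ _ _ K3 T4) as T5. clear K3 T4.
  pose proof (Cmod_ge_0 h). assert (0 <= eps / 2 * Cmod h) by (apply Rmult_le_pos; lra).
  lra.
Qed.

Lemma heat_solution_initial (z : C) : heat_solution (RtoC 0, z) = f z.
Proof.
  refine (eq_trans (is_series_C_unique _ _ _ (heat_solution_series (RtoC 0) z) (is_series_C_single _ _)) _).
  - intros n. rewrite Cpow_0_l. ring.
  - unfold heat_coef. change (C_derive_n f (2 * 0) z) with (f z). change (INR (fact 0)) with 1.
    change (RtoC 0 ^ 0)%C with (RtoC 1). field.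
Qed.

End Converse.

Theorem theorem3 :
  (forall F : C * C -> C,
     entire2 F ->
     heat_equation F ->
     let f := fun z : C => F (RtoC 0, z) in
     Rbar_le (Finite 0) (order f) /\
     Rbar_le (order f) (Finite 2) /\
     (order f = Finite 2 -> growth_type f = Finite 0))
  /\
  (forall f : C -> C,
     entire f ->
     Rbar_le (Finite 0) (order f) ->
     Rbar_le (order f) (Finite 2) ->
     (order f = Finite 2 -> growth_type f = Finite 0) ->
     exists F : C * C -> C,
       (forall t z : C,
          @is_series C_AbsRing C_NormedModule
            (fun j : nat =>
               (C_derive_n f (2 * j) z / RtoC (INR (fact j)) * t ^ j)%C)
            (F (t, z))) /\
       entire2 F /\
       heat_equation F /\
       (forall z : C, F (RtoC 0, z) = f z)).
Proof.
  split.
  - intros F HF Hheat f.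
    assert (Hf : entire f) by (apply (entire_space F HF)).
    assert (Hs : gaussian_small f) by (apply (heat_initial_gaussian_small F HF Hheat)).
    split; [now apply order_nonneg|]. split; [now apply gaussian_small_order|].
    now apply gaussian_small_type.
  - intros f Hf _ Ho Ht.
    pose proof (order_type_gaussian_small f Hf Ho Ht) as Hs.
    exists (heat_solution f). split; [|split; [|split]].
    + intros t z. now apply heat_solution_series.
    + now apply heat_solution_entire2.
    + now apply heat_solution_heat.
    + intros z. now apply heat_solution_initial.
Qed.
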